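(* Let $\mathcal I_{\mathrm{reg}}\subseteq\operatorname{int}(\mathcal E)$ be an open interval of maximal length on which the Jacobian $J(X^*(\epsilon),y^*(\epsilon),S^*(\epsilon))$ is nonsingular, where $(X^*(\epsilon),y^*(\epsilon),S^*(\epsilon))$ denotes a maximally complementary solution at $\epsilon$. Let $\bar\epsilon\in\operatorname{int}(\mathcal E)$ be a boundary point of $\mathcal I_{\mathrm{reg}}$ (if one exists). If the strict complementarity condition fails at $\bar\epsilon$ (i.e. no strictly complementary optimal solution exists at $\bar\epsilon$), then $\bar\epsilon$ is a transition point of the optimal partition. In particular, $\bar\epsilon$ is a transition point whenever both $\mathcal P^*(\bar\epsilon)$ and $\mathcal D^*(\bar\epsilon)$ are singletons.
   Context: Setting. $\mathbb S^n$ is the space of real symmetric $n\times n$ matrices with inner product $\langle C,X\rangle=\operatorname{trace}(CX)$; $X\succeq0$ ($\succ0$) means positive semidefinite (definite). Given $C,\bar C,A^1,\dots,A^m\in\mathbb S^n$ and $b\in\mathbb R^m$, consider for $\epsilon\in\mathbb R$ $$(\mathrm P_\epsilon)\ \min\{\langle C+\epsilon\bar C,X\rangle : \langle A^i,X\rangle=b_i,\ i=1,\dots,m,\ X\succeq0\},$$ $$(\mathrm D_\epsilon)\ \max\{b^Ty : \textstyle\sum_i y_iA^i+S=C+\epsilon\bar C,\ S\succeq0,\ y\in\mathbb R^m\}.$$ Standing assumptions: $A^1,\dots,A^m$ are linearly independent, and at $\epsilon=0$ there is a feasible $(X,y,S)$ of $(\mathrm P_0),(\mathrm D_0)$ with $X\succ0$,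 $S\succ0$. $v(\epsilon)$ is the optimal value of $(\mathrm P_\epsilon)$ and $\mathcal E=\{\epsilon: v(\epsilon)>-\infty\}$, which is a closed interval with $0$ in its interior. For $\epsilon\in\operatorname{int}(\mathcal E)$ strong duality holds and the sets of optimal solutions $\mathcal P^*(\epsilon)$ (of $X$) and $\mathcal D^*(\epsilon)$ (of $(y,S)$) are nonempty and compact. An optimal solution $(X,y,S)\in\mathcal P^*(\epsilon)\times\mathcal D^*(\epsilon)$ satisfies $XS=0$. It is maximally complementary if $X\in\operatorname{ri}(\mathcal P^*(\epsilon))$ and $(y,S)\in\operatorname{ri}(\mathcal D^*(\epsilon))$ (relative interiors), and strictly complementary if $X+S\succ0$. Optimal partition: for a maximally complementary solution $(X^*(\epsilon),y^*(\epsilon),S^*(\epsilon))$, let $\mathcal B(\epsilon)$ be the column space of $X^*(\epsilon)$, $\mathcal N(\epsilon)$ the column space of $S^*(\epsilon)$, $\mathcal T(\epsilon)=(\mathcal B(\epsilon)+\mathcal N(\epsilon))^\perp$, and $\pi(\epsilon)=(\mathcal B(\epsilon),\mathcal T(\epsilon),\mathcal N(\epsilon))$ (independent of the choice of maximally complementary solution). An invariancy set is the set of all $\epsilon\in\operatorname{int}(\mathcal E)$ having a given common value of $\pi$. A point $\bar\epsilon\in\operatorname{int}(\mathcal E)$ is a transition point if $\{\bar\epsilon\}$ is a singleton invariancy set and for every $\xi>0$ (with $(\bar\epsilon-\xi,\bar\epsilon+\xi)\subseteq\operatorname{int}(\mathcal E)$) there is $\epsilon\in(\bar\epsilon-\xi,\bar\epsilon+\xi)$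 with $\dim\mathcal B(\epsilon)\ne\dim\mathcal B(\bar\epsilon)$ or $\dim\mathcal N(\epsilon)\neq\dim\mathcal N(\bar\epsilon)$. Jacobian: $\operatorname{svec}:\mathbb S^n\to\mathbb R^{n(n+1)/2}$ stacks the upper triangular part of a symmetric matrix into a vector with off-diagonal entries multiplied by $\sqrt2$; $\mathcal A=(\operatorname{svec}(A^1),\dots,\operatorname{svec}(A^m))^T$; the symmetric Kronecker product of square matrices $K_1,K_2$ is defined by $(K_1\otimes_sK_2)\operatorname{svec}(H)=\frac12\operatorname{svec}(K_2HK_1^T+K_1HK_2^T)$ for all symmetric $H$; and $$J(X,y,S)=\begin{pmatrix}\mathcal A&0&0\\0&\mathcal A^T&I_{n(n+1)/2}\\S\otimes_sI_n&0&X\otimes_sI_n\end{pmatrix}.$$ *)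

(* Defs.v *)
From HB Require Import structures.
From mathcomp Require Import all_boot all_order all_algebra.
From mathcomp Require Import all_classical all_reals all_analysis.

Set Implicit Arguments.
Unset Strict Implicit.
Unset Printing Implicit Defensive.

Import Order.TTheory GRing.Theory Num.Theory.
Import numFieldNormedType.Exports.

Local Open Scope classical_set_scope.
Local Open Scope ring_scope.

Section Convexity.
Variable R : realType.

Definition affine_hull (V : lmodType R) (K : set V) : set V :=
  [set x | exists (k : nat) (t : 'I_k -> R) (p : 'I_k -> V),
     [/\ forall i, K (p i), \sum_i t i = 1 & x = \sum_i t i *: p i]].

Definition relative_interior (V : normedModType R) (K : set V) : set V :=
  [set x | K x /\ \forall z \near x, affine_hull K z -> K z].

Definition singleton_set (T : Type) (K : set T) : Prop :=
  exists x, K = [set x].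

Definition boundary (T : topologicalType) (K : set T) : set T :=
  closure K `\` interior K.

End Convexity.

Section SymmetricMatrices.
Variables (R : realType) (n : nat).

Definition symmx (X : 'M[R]_n) : Prop := X^T = X.

Definition psdmx (X : 'M[R]_n) : Prop :=
  symmx X /\ forall v : 'cV[R]_n, 0 <= (v^T *m X *m v) 0 0.

Definition pdmx (X : 'M[R]_n) : Prop :=
  symmx X /\ forall v : 'cV[R]_n, v != 0 -> 0 < (v^T *m X *m v) 0 0.

Definition inner (C X : 'M[R]_n) : R := \tr (C *m X).

Definition upper := {p : 'I_n * 'I_n | (p.1 <= p.2)%N}.

(* Equal to n(n+1)/2, see sdimE. *)
Definition sdim : nat := #|{: upper}|.

Definition svec (X : 'M[R]_n) : 'cV[R]_sdim :=
  \col_k (let p := val (enum_val k : upper) in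
          if p.1 == p.2 then X p.1 p.2 else Num.sqrt 2 * X p.1 p.2).

(* The symmetric matrix whose svec is the k-th unit vector, see svec_sbasis. *)
Definition sbasis (k : 'I_sdim) : 'M[R]_n :=
  let p := val (enum_val k : upper) in
  if p.1 == p.2 then delta_mx p.1 p.1
  else (Num.sqrt 2)^-1 *: (delta_mx p.1 p.2 + delta_mx p.2 p.1).

(* The matrix determined by skron_svec (see skron_unique); its columns are the
   images of the unit vectors svec (sbasis l). *)
Definition skron (K1 K2 : 'M[R]_n) : 'M[R]_sdim :=
  \matrix_(k, l) (2^-1 *: svec (K2 *m sbasis l *m K1^T
                                + K1 *m sbasis l *m K2^T)) k 0.

Lemma sdimE : sdim = (n * n.+1)./2.
Proof.
have -> : sdim = (\sum_(p : 'I_n * 'I_n | (p.1 <= p.2)%N) 1)%N.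
  by rewrite /sdim card_sig sum1_card; apply: eq_card.
rewrite -(pair_big_dep predT (fun i j : 'I_n => (i <= j)%N)
  (fun _ _ => 1%N)) /=.
rewrite (exchange_big_dep predT) //=.
have -> : (\sum_(j < n) \sum_(i < n | (i <= j)%N) 1 =
           \sum_(j < n) j.+1)%N.
  apply: eq_bigr => j _.
  rewrite -(big_ord_widen n (fun=> 1%N) (ltn_ord j)) /=.
  by rewrite sum1_card card_ord.
have <- : (\sum_(i < n.+1) i = \sum_(j < n) j.+1)%N.
  by rewrite big_ord_recl add0n.
by rewrite -(big_mkord predT id) bin2_sum bin2 mulnC.
Qed.

Lemma svec_sbasis (k : 'I_sdim) : svec (sbasis k) = delta_mx k 0.
Proof.
apply/colP => l; rewrite !mxE eqxx andbT /sbasis -(inj_eq enum_val_inj).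
case: (enum_val l : upper) => [[a b] /= ab].
case: (enum_val k : upper) => [[c d] /= cd].
rewrite -[_ == exist _ _ _](inj_eq val_inj) xpair_eqE.
have s2 : Num.sqrt 2 != 0 :> R by rewrite sqrtr_eq0 -ltNge ltr0n.
case: (eqVneq a b) ab => [<-|nab] ab; case: (eqVneq c d) cd => [<-|ncd] cd;
  rewrite !mxE.
- by [].
- have -> : (a == c) && (a == d) = false.
    by apply: contraNF ncd => /andP[/eqP<- /eqP<-].
  have -> : (a == d) && (a == c) = false.
    by apply: contraNF ncd => /andP[/eqP<- /eqP<-].
  by rewrite addr0 mulr0.
- have -> : (a == c) && (b == c) = false.
    by apply: contraNF nab => /andP[/eqP-> /eqP->].
  by rewrite mulr0.
- have -> : (a == d) && (b == c) = false.
    apply: contraNF nab => /andP[/eqP ad /eqP bc].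
    by rewrite -val_eqE eqn_leq ab /= ad bc cd.
  by rewrite addr0 mulrA divff // mul1r.
Qed.

Lemma svec_linear a (X Y : 'M[R]_n) : svec (a *: X + Y) = a *: svec X + svec Y.
Proof.
apply/colP => k; rewrite !mxE /=; case: ifP => _; rewrite !mxE //.
by rewrite mulrDr mulrCA.
Qed.

HB.instance Definition _ :=
  GRing.isLinear.Build R 'M[R]_n 'cV[R]_sdim *:%R svec svec_linear.

Lemma svec_inj (X Y : 'M[R]_n) : symmx X -> symmx Y -> svec X = svec Y -> X = Y.
Proof.
move=> sX sY /colP XY.
have s2 : Num.sqrt 2 != 0 :> R by rewrite sqrtr_eq0 -ltNge ltr0n.
have up (i j : 'I_n) : (i <= j)%N -> X i j = Y i j.
  move=> ij; pose k : 'I_sdim := enum_rank (exist _ (i, j) ij : upper).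
  move: (XY k); rewrite !mxE enum_rankK /=; case: eqP => // _.
  exact: mulfI.
apply/matrixP => i j; have [/up//|/ltnW/up] := leqP i j.
by rewrite -{2}sX -{2}sY !mxE.
Qed.

Lemma symmx_sbasis (k : 'I_sdim) : symmx (sbasis k).
Proof.
rewrite /symmx /sbasis; case: ifP => _; first by rewrite trmx_delta.
by rewrite linearZ linearD /= !trmx_delta addrC.
Qed.

Lemma svec_sum (H : 'M[R]_n) : symmx H ->
  H = \sum_k svec H k 0 *: sbasis k.
Proof.
move=> sH; apply: svec_inj => //.
  rewrite /symmx linear_sum; apply: eq_bigr => k _; rewrite linearZ /=.
  by rewrite symmx_sbasis.
rewrite linear_sum /= [LHS]matrix_sum_delta; apply: eq_bigr => k _.
by rewrite big_ord1 linearZ /= svec_sbasis.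
Qed.

Lemma skron_svec (K1 K2 H : 'M[R]_n) : symmx H ->
  skron K1 K2 *m svec H =
  2^-1 *: svec (K2 *m H *m K1^T + K1 *m H *m K2^T).
Proof.
move=> /svec_sum sH; rewrite {2 3}sH !mulmx_sumr !mulmx_suml -big_split /=.
rewrite linear_sum scaler_sumr; apply/colP => k.
rewrite mxE summxE; apply: eq_bigr => l _.
rewrite -!scalemxAr -!scalemxAl -scalerDr linearZ /= scalerA.
rewrite [2^-1 * _]mulrC -scalerA [RHS]mxE mulrC; congr (_ * _).
by rewrite mxE.
Qed.

Lemma skron_unique (K1 K2 : 'M[R]_n) (M : 'M[R]_sdim) :
  (forall H, symmx H ->
    M *m svec H = 2^-1 *: svec (K2 *m H *m K1^T + K1 *m H *m K2^T)) ->
  M = skron K1 K2.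
Proof.
move=> MP; apply/matrixP => k l; have := MP _ (symmx_sbasis l).
rewrite svec_sbasis -colE => /colP /(_ k).
by rewrite [in LHS]mxE => ->; rewrite [RHS]mxE.
Qed.

End SymmetricMatrices.

(* Data of the parametric pair (P_e), (D_e): the objective is
   cost + e *: dcost, the constraints are <constr i, X> = rhs i. *)
Record param_sdp (R : realType) (n m : nat) := ParamSDP {
  cost : 'M[R]_n;
  dcost : 'M[R]_n;
  constr : 'I_m -> 'M[R]_n;
  rhs : 'cV[R]_m }.

Section ParametricSDP.
Variables (R : realType) (n m : nat) (P : param_sdp R n m).

Definition symmetric_data : Prop :=
  [/\ symmx (cost P), symmx (dcost P) & forall i, symmx (constr P i)].

Definition independent_constraints : Prop :=
  free [tuple constr P i | i < m].

Definition cost_at (e : R) : 'M[R]_n := cost P + e *: dcost P.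

Definition primal_feasible : set 'M[R]_n :=
  [set X | (forall i, inner (constr P i) X = rhs P i 0) /\ psdmx X].

Definition dual_feasible (e : R) : set ('cV[R]_m * 'M[R]_n) :=
  [set z : 'cV[R]_m * 'M[R]_n |
     \sum_i z.1 i 0 *: constr P i + z.2 = cost_at e /\ psdmx z.2].

Definition interior_point_at0 : Prop :=
  exists (X : 'M[R]_n) (y : 'cV[R]_m) (S : 'M[R]_n),
    [/\ primal_feasible X, dual_feasible 0 (y, S), pdmx X & pdmx S].

Definition dual_objective (y : 'cV[R]_m) : R := ((rhs P)^T *m y) 0 0.

Definition optimal_value (e : R) : \bar R :=
  ereal_inf [set (inner (cost_at e) X)%:E | X in primal_feasible].

Definition bounded_params : set R := [set e | (-oo < optimal_value e)%E].

Definition int_params : set R := interior bounded_params.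

Definition primal_optimal (e : R) : set 'M[R]_n :=
  [set X | primal_feasible X /\
     forall X', primal_feasible X' ->
       inner (cost_at e) X <= inner (cost_at e) X'].

Definition dual_optimal (e : R) : set ('cV[R]_m * 'M[R]_n) :=
  [set z | dual_feasible e z /\
     forall z', dual_feasible e z' ->
       dual_objective z'.1 <= dual_objective z.1].

Definition max_complementary (e : R)
    (X : 'M[R]_n) (y : 'cV[R]_m) (S : 'M[R]_n) : Prop :=
  relative_interior (primal_optimal e) X /\
  relative_interior (dual_optimal e) (y, S).

Definition has_strictly_complementary (e : R) : Prop :=
  exists X y S,
    [/\ primal_optimal e X, dual_optimal e (y, S) & pdmx (X + S)].

Definition constraint_mx : 'M[R]_(m, sdim n) :=
  \matrix_(i, k) svec (constr P i) k 0.

Lemma jacobian_width : (sdim n + m + sdim n = m + sdim n + sdim n)%N.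
Proof. by rewrite (addnC (sdim n) m). Qed.

Definition jacobian (X : 'M[R]_n) (y : 'cV[R]_m) (S : 'M[R]_n) :
    'M[R]_(m + sdim n + sdim n) :=
  castmx (erefl, jacobian_width)
    (col_mx
      (col_mx
        (row_mx (row_mx constraint_mx 0) 0)
        (row_mx (row_mx 0 constraint_mx^T) 1%:M))
      (row_mx (row_mx (skron S 1%:M) 0) (skron X 1%:M))).

(* From here on Xs, ys, Ss select one solution for each parameter; the
   theorem assumes it maximally complementary at every point of int_params, and
   values elsewhere are irrelevant. *)
Variables (Xs : R -> 'M[R]_n) (ys : R -> 'cV[R]_m) (Ss : R -> 'M[R]_n).

Definition max_complementary_selection : Prop :=
  forall e, int_params e -> max_complementary e (Xs e) (ys e) (Ss e).

(* Subspaces of R^n are row spaces; <<_>> is a canonical generating matrix, so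
   equality of subspaces is equality of matrices. The rows of kermx W^T span the
   orthogonal complement of the row space of W. *)
Definition partB (e : R) : 'M[R]_n := <<(Xs e)^T>>%MS.
Definition partN (e : R) : 'M[R]_n := <<(Ss e)^T>>%MS.
Definition partT (e : R) : 'M[R]_n :=
  <<kermx (partB e + partN e)%MS^T>>%MS.

Definition opt_partition (e : R) : 'M[R]_n * 'M[R]_n * 'M[R]_n :=
  (partB e, partT e, partN e).

Definition invariancy_set (e0 : R) : set R :=
  [set e | int_params e /\ opt_partition e = opt_partition e0].

Definition transition_point (e0 : R) : Prop :=
  int_params e0 /\
  invariancy_set e0 = [set e0] /\
  forall xi : R, 0 < xi ->
    (forall e, e0 - xi < e < e0 + xi -> int_params e) ->
    exists e, e0 - xi < e < e0 + xi /\
      (\rank (partB e) <> \rank (partB e0) \/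
       \rank (partN e) <> \rank (partN e0)).

Definition regular_interval (I : set R) : Prop :=
  [/\ is_interval I, open I, I `<=` int_params &
      forall e, I e -> jacobian (Xs e) (ys e) (Ss e) \in unitmx].

Definition maximal_regular_interval (I : set R) : Prop :=
  regular_interval I /\
  forall I', regular_interval I' -> I `<=` I' -> I' = I.

End ParametricSDP.

(* Main.v *)
(* Nonsingularity of the Jacobian at a complementary pair forces strict
   complementarity. If the partition at [e1 <> ebar] coincided with the one at
   [ebar], interpolating the two dual solutions would transport a strictly
   complementary pair from a nearby regular parameter to [ebar]; and since
   [rank X + rank S = n] characterises strict complementarity, the ranks must
   drop at [ebar]. If both optimal sets at [ebar] are singletons and strict
   complementarity holds, the Jacobian is nonsingular at [ebar], and by
   compactness also at all nearby parameters, which contradicts the maximality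
   of the regular interval. *)

Require Import Defs.
From HB Require Import structures.
From mathcomp Require Import all_boot all_order all_algebra.
From mathcomp Require Import all_classical all_reals all_analysis.
From mathcomp Require Import ring lra.
Import Order.TTheory GRing.Theory Num.Theory.
Import numFieldNormedType.Exports.
Local Open Scope classical_set_scope.
Local Open Scope ring_scope.

Set Implicit Arguments.
Unset Strict Implicit.
Unset Printing Implicit Defensive.

(** * Semidefinite matrices: factorisation, perturbation within the range, trace bounds *)

Section QuadraticForms.
Variables (R : realType) (n : nat).
Implicit Types (X Y S : 'M[R]_n) (u v w : 'cV[R]_n) (a c t : R).

(** The selected solutions carry no continuity in the parameter, so solutions at different
    parameters are compared only through exact identities. The parameter enters through the cost
    alone: the primal feasible set is fixed and dual feasible points combine affinely in [e], which
    is why the interpolation takes place on the dual side, through [N]. Everything rests on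
    complementarity of optimal pairs, hence on strong duality at each interior parameter; it comes
    from projecting a point just below the optimal value onto an image of the semidefinite cone. For
    a unique strictly complementary solution, a kernel vector of the Jacobian is a direction along
    the optimal faces, and uniqueness kills it. Nearby solutions are not followed by an implicit
    function: pairs with singular Jacobian form a compact set on which a residual vanishing only at
    the unique solution stays bounded below, while the residual of the selected pair at [e] is of
    order [|e - ebar|]. *)

Definition bform X u v : R := (u^T *m X *m v) 0 0.

Lemma bformD X Y u v : bform (X + Y) u v = bform X u v + bform Y u v.
Proof. by rewrite /bform mulmxDr mulmxDl mxE. Qed.

Lemma bformZ a X u v : bform (a *: X) u v = a * bform X u v.
Proof. by rewrite /bform -scalemxAr -scalemxAl mxE. Qed.

Lemma bformDl X u v w : bform X (u + v) w = bform X u w + bform X v w.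
Proof. by rewrite /bform linearD /= !mulmxDl mxE. Qed.

Lemma bformDr X u v w : bform X w (u + v) = bform X w u + bform X w v.
Proof. by rewrite /bform mulmxDr mxE. Qed.

Lemma bformZl X a u v : bform X (a *: u) v = a * bform X u v.
Proof. by rewrite /bform linearZ /= -!scalemxAl mxE. Qed.

Lemma bformZr X a u v : bform X u (a *: v) = a * bform X u v.
Proof. by rewrite /bform -scalemxAr mxE. Qed.

Lemma bformC X u v : symmx X -> bform X u v = bform X v u.
Proof.
by move=> sX; rewrite /bform -[in LHS](trmxK (_ *m v)) mxE !trmx_mul trmxK sX mulmxA.
Qed.

Lemma bform_mul X Y v : bform X (Y *m v) (Y *m v) = bform (Y^T *m X *m Y) v v.
Proof. by rewrite /bform trmx_mul !mulmxA. Qed.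

Lemma bform_outer w w' u v :
  bform (w *m w'^T) u v = (u^T *m w) 0 0 * (w'^T *m v) 0 0.
Proof. by rewrite /bform !mulmxA -mulmxA mxE big_ord1. Qed.

Lemma sqnorm_ge0 k (v : 'cV[R]_k) : 0 <= (v^T *m v) 0 0.
Proof. by rewrite mxE sumr_ge0// => i _; rewrite mxE -expr2 sqr_ge0. Qed.

Lemma sqnorm_eq0 k (v : 'cV[R]_k) : (v^T *m v) 0 0 = 0 -> v = 0.
Proof.
rewrite mxE => /eqP; rewrite psumr_eq0; last first.
  by move=> i _; rewrite mxE -expr2 sqr_ge0.
move=> /allP v0; apply/colP => i; rewrite [RHS]mxE.
by move: (v0 i (mem_index_enum _)); rewrite !mxE -expr2 sqrf_eq0 => /eqP.
Qed.

Lemma trmul_eq0 k l (W : 'M[R]_(k, l)) : W^T *m W = 0 -> W = 0.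
Proof.
move=> W0; apply/matrixP => i j; rewrite [RHS]mxE.
have : ((col j W)^T *m col j W) 0 0 = 0.
  have := congr1 (fun M : 'M[R]_(l, l) => M j j) W0; rewrite [RHS]mxE => <-.
  by rewrite !mxE; apply: eq_bigr => k0 _; rewrite !mxE.
by move=> /sqnorm_eq0 /colP /(_ i); rewrite !mxE.
Qed.

Lemma psdmx_form X v : psdmx X -> 0 <= bform X v v.
Proof. by case=> _; apply. Qed.

Lemma symmxD X Y : symmx X -> symmx Y -> symmx (X + Y).
Proof. by rewrite /symmx linearD /= => -> ->. Qed.

Lemma symmxZ a X : symmx X -> symmx (a *: X).
Proof. by rewrite /symmx linearZ /= => ->. Qed.

Lemma symmxB X Y : symmx X -> symmx Y -> symmx (X - Y).
Proof. by rewrite /symmx linearB /= => -> ->. Qed.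

Lemma symmx1 : symmx (1%:M : 'M[R]_n).
Proof. exact: trmx1. Qed.

Lemma psdmxD X Y : psdmx X -> psdmx Y -> psdmx (X + Y).
Proof.
move=> [sX pX] [sY pY]; split; first exact: symmxD.
by move=> v; rewrite -/(bform _ _ _) bformD addr_ge0 ?pX ?pY.
Qed.

Lemma psdmxZ a X : 0 <= a -> psdmx X -> psdmx (a *: X).
Proof.
move=> a0 [sX pX]; split; first exact: symmxZ.
by move=> v; rewrite -/(bform _ _ _) bformZ mulr_ge0 ?pX.
Qed.

Lemma pdmxZ a X : 0 < a -> pdmx X -> pdmx (a *: X).
Proof.
move=> a0 [sX pX]; split; first exact: symmxZ.
by move=> v v0; rewrite -/(bform _ _ _) bformZ mulr_gt0 ?pX.
Qed.

Lemma pdmx_psd X : pdmx X -> psdmx X.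
Proof.
move=> [sX pX]; split=> // v; have [->|/pX/ltW//] := eqVneq v 0.
by rewrite mulmx0 mxE.
Qed.

Lemma pdmxD_psd X Y : psdmx X -> pdmx Y -> pdmx (X + Y).
Proof.
move=> [sX pX] [sY pY]; split; first exact: symmxD.
by move=> v v0; rewrite -/(bform _ _ _) bformD ltr_wpDl ?pX ?pY.
Qed.

Lemma psdmx_gram k (W : 'M[R]_(k, n)) : psdmx (W^T *m W).
Proof.
split=> [|v]; first by rewrite /symmx trmx_mul trmxK.
by have := sqnorm_ge0 (W *m v); rewrite trmx_mul !mulmxA.
Qed.

Lemma psdmx_conj X k (W : 'M[R]_(n, k)) : psdmx X -> psdmx (W^T *m X *m W).
Proof.
move=> [sX pX]; split=> [|v]; first by rewrite /symmx !trmx_mul trmxK sX mulmxA.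
by have := pX (W *m v); rewrite trmx_mul !mulmxA.
Qed.

Lemma psdmx_CauchySchwarz X u v : psdmx X ->
  bform X u v ^+ 2 <= bform X u u * bform X v v.
Proof.
move=> psdX; have [sX _] := psdX.
set a := bform X u u; set b := bform X u v; set c := bform X v v.
have quad t s : 0 <= t ^+ 2 * a + 2 * t * s * b + s ^+ 2 * c.
  have := psdmx_form (t *: u + s *: v) psdX.
  rewrite bformDl !bformDr !bformZl !bformZr (bformC v u sX) -/a -/b -/c.
  by congr (_ <= _); ring.
have a0 : 0 <= a := psdmx_form u psdX.
have c0 : 0 <= c := psdmx_form v psdX.
have [a0'|a0'] := eqVneq a 0.
  (* For [a = 0] this value of the form is [- (c + 2) * b ^+ 2], which forces [b = 0]. *)
  rewrite a0' mul0r; have := quad (- (c + 1)) b.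
  by rewrite a0' mulr0; nra.
have {a0 a0'} a0 : 0 < a by rewrite lt_def a0' a0.
have := quad (- b) a.
have -> : (- b) ^+ 2 * a + 2 * - b * a * b + a ^+ 2 * c = a * (a * c - b ^+ 2).
  by ring.
by rewrite pmulr_rge0// subr_ge0.
Qed.

(** Cauchy-Schwarz for the vectors [X *m v] and [v]: the left-hand side is the fourth power of the
    norm of [X *m v]. *)
Lemma psdmx_form0 X v : psdmx X -> bform X v v = 0 -> X *m v = 0.
Proof.
move=> psdX v0; have := psdmx_CauchySchwarz (X *m v) v psdX.
rewrite v0 mulr0 => le0; apply: sqnorm_eq0; apply/eqP; rewrite -sqrf_eq0.
rewrite eq_le sqr_ge0 andbT; apply: le_trans le0.
by rewrite /bform -mulmxA.
Qed.

Lemma psdmxD_ker X Y v : psdmx X -> psdmx Y -> (X + Y) *m v = 0 ->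
  X *m v = 0 /\ Y *m v = 0.
Proof.
move=> pX pY XY0; have : bform (X + Y) v v = 0.
  by rewrite /bform -mulmxA XY0 mulmx0 mxE.
have := psdmx_form v pX; have := psdmx_form v pY; rewrite bformD => Y0 X0 XY.
by split; apply: psdmx_form0 => //; lra.
Qed.

Lemma pdmxE X : psdmx X -> (forall v, X *m v = 0 -> v = 0) -> pdmx X.
Proof.
move=> pX injX; split=> [|v v0]; first by case: pX.
rewrite lt_def (psdmx_form v pX) andbT; apply: contra_neq v0.
by move=> /(psdmx_form0 pX); exact: injX.
Qed.

Lemma pdmx_inj X v : pdmx X -> X *m v = 0 -> v = 0.
Proof.
move=> [_ pX] Xv; apply/eqP; apply: contraT => /pX.
by rewrite -mulmxA Xv mulmx0 mxE ltxx.
Qed.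

Lemma unitmx_ker k (M : 'M[R]_k) :
  (forall v : 'cV[R]_k, M *m v = 0 -> v = 0) -> M \in unitmx.
Proof.
move=> injM; rewrite -unitmx_tr -row_free_unit; apply/row_freeP.
apply/row_freeP; rewrite -kermx_eq0; apply/eqP/row_matrixP => i; rewrite row0.
apply: trmx_inj; rewrite trmx0; apply: injM.
rewrite -[M in M *m _]trmxK -trmx_mul -row_mul mulmx_ker row0 trmx0 //.
Qed.

Lemma pdmx_unit X : pdmx X -> X \in unitmx.
Proof. by move=> pX; apply: unitmx_ker => v; exact: pdmx_inj. Qed.

(** The columns of [cokermx X] lie in the kernel of [X], hence of [Y]. For symmetric matrices the
    inclusion of row spaces is that of ranges, the form needed to perturb semidefinite matrices. *)
Lemma submx_ker X Y : (forall v, X *m v = 0 -> Y *m v = 0) -> (Y <= X)%MS.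
Proof.
move=> kXY; rewrite submxE; apply/eqP/matrixP => i j.
have : Y *m col j (cokermx X) = 0.
  by apply: kXY; rewrite colE mulmxA mulmx_coker mul0mx.
by rewrite colE mulmxA -colE => /colP /(_ i); rewrite !mxE.
Qed.

(* Subtracting [a^-1 (X v) (X v)^T] with [a = v^T X v] keeps X positive
   semidefinite (Cauchy-Schwarz) and enlarges its kernel. *)
Lemma psdmx_sum_sq X : psdmx X ->
  exists s : seq 'cV[R]_n, X = \sum_(w <- s) w *m w^T.
Proof.
have [k] := ubnP (\rank X); elim: k => // k IH in X *; rewrite ltnS => rk psdX.
have [X0|nX0] := pselect (forall v, X *m v = 0).
  exists [::]; rewrite big_nil; apply/matrixP => i j.
  by have /colP/(_ i) := X0 (delta_mx j 0); rewrite -colE !mxE.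
have /existsNP [v Xv0] := nX0; have [sX _] := psdX.
have a0 : 0 < bform X v v.
  rewrite lt_def (psdmx_form v psdX) andbT; apply: contra_notN Xv0 => /eqP.
  exact: psdmx_form0.
set a := bform X v v in a0; pose Y := X - a^-1 *: (X *m v *m (X *m v)^T).
have YE u w : bform Y u w = bform X u w - a^-1 * (bform X v u * bform X v w).
  rewrite /Y -scaleN1r bformD !bformZ mulN1r; congr (_ - _ * _).
  by rewrite bform_outer (bformC v u sX) /bform trmx_mul sX !mulmxA.
have sY : symmx Y.
  apply: symmxB => //; apply: symmxZ.
  by rewrite /symmx trmx_mul trmxK.
have psdY : psdmx Y.
  split=> // u; rewrite -/(bform _ _ _) YE subr_ge0 ler_pdivrMl// -expr2.
  exact: psdmx_CauchySchwarz.
have kY u : X *m u = 0 -> Y *m u = 0.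
  move=> Xu; apply: (psdmx_form0 psdY).
  by rewrite YE {1 3}/bform -!mulmxA Xu !mulmx0 mxE !mulr0 subr0.
have Yv : Y *m v = 0.
  by apply: (psdmx_form0 psdY); rewrite YE -/a mulKf ?subrr// gt_eqF.
have ltYX : (Y < X)%MS.
  rewrite ltmxE submx_ker//=; apply/negP => /submxP[D XD]; apply: Xv0.
  by rewrite XD -mulmxA Yv mulmx0.
have [s sE] := IH _ (leq_trans (rank_ltmx ltYX) rk) psdY.
exists (Num.sqrt a^-1 *: (X *m v) :: s); rewrite big_cons -sE /Y.
rewrite linearZ /= -scalemxAr -scalemxAl scalerA -expr2 sqr_sqrtr; last first.
  by rewrite invr_ge0 ltW.
by rewrite addrC subrK.
Qed.

Lemma innerC X Y : inner X Y = inner Y X.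
Proof. exact: mxtrace_mulC. Qed.

Lemma innerDl X Y S : inner (X + Y) S = inner X S + inner Y S.
Proof. by rewrite /inner mulmxDl linearD. Qed.

Lemma innerDr X Y S : inner S (X + Y) = inner S X + inner S Y.
Proof. by rewrite innerC innerDl !(innerC S). Qed.

Lemma innerZl a X Y : inner (a *: X) Y = a * inner X Y.
Proof. by rewrite /inner -scalemxAl linearZ. Qed.

Lemma innerZr a X Y : inner X (a *: Y) = a * inner X Y.
Proof. by rewrite innerC innerZl innerC. Qed.

Lemma innerNl X Y : inner (- X) Y = - inner X Y.
Proof. by rewrite -scaleN1r innerZl mulN1r. Qed.

Lemma innerNr X Y : inner X (- Y) = - inner X Y.
Proof. by rewrite innerC innerNl innerC. Qed.

Lemma innerBl X Y S : inner (X - Y) S = inner X S - inner Y S.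
Proof. by rewrite innerDl innerNl. Qed.

Lemma innerBr X Y S : inner S (X - Y) = inner S X - inner S Y.
Proof. by rewrite innerDr innerNr. Qed.

Lemma inner0l X : inner 0 X = 0.
Proof. by rewrite /inner mul0mx mxtrace0. Qed.

Lemma inner_suml (I : Type) (r : seq I) (F : I -> 'M[R]_n) X :
  inner (\sum_(i <- r) F i) X = \sum_(i <- r) inner (F i) X.
Proof. by rewrite /inner mulmx_suml linear_sum. Qed.

Lemma inner1l X : inner 1%:M X = \tr X.
Proof. by rewrite /inner mul1mx. Qed.

Lemma inner_outer S w : inner S (w *m w^T) = bform S w w.
Proof.
rewrite /inner mulmxA mxtrace_mulC /bform mulmxA.
by rewrite [LHS]/mxtrace big_ord1.
Qed.

Lemma inner_psd_ge0 X S : psdmx X -> psdmx S -> 0 <= inner X S.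
Proof.
move=> /psdmx_sum_sq[s ->] pS; rewrite inner_suml sumr_ge0// => w _.
by rewrite innerC inner_outer psdmx_form.
Qed.

Lemma inner_psd_eq0 X S : psdmx X -> psdmx S -> inner X S = 0 -> X *m S = 0.
Proof.
move=> /psdmx_sum_sq[s ->] pS; have [sS _] := pS; rewrite inner_suml => /eqP.
rewrite psumr_eq0; last first.
  by move=> w _; rewrite innerC inner_outer psdmx_form.
move=> /allP s0; rewrite mulmx_suml big_seq big1// => w /s0 /=.
rewrite innerC inner_outer => /eqP/(psdmx_form0 pS) Sw.
by rewrite -mulmxA -[w^T *m S]trmxK trmx_mul trmxK sS Sw trmx0 mulmx0.
Qed.

(** With [X] a sum of terms [w w^T], the vector [X v] has coefficients [w^T v], each of square at
    most [v^T X v]; so any quadratic form in [X v] is controlled by [v^T X v]. *)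
Lemma psdmx_conj_dominated X Z : psdmx X ->
  exists2 c, 0 < c & forall v, `|bform Z (X *m v) (X *m v)| <= c * bform X v v.
Proof.
move=> pX; have [s sE] := psdmx_sum_sq pX.
exists (1 + \sum_(w <- s) \sum_(u <- s) `|bform Z w u|).
  by rewrite ltr_pwDl// sumr_ge0// => w _; rewrite sumr_ge0.
move=> v; set q := bform X v v.
have qE : q = \sum_(w <- s) ((w^T *m v) 0 0) ^+ 2.
  rewrite /q {1}sE /bform mulmx_sumr mulmx_suml summxE; apply: eq_bigr => w _.
  rewrite -/(bform _ _ _) bform_outer expr2; congr (_ * _).
  by rewrite -[in RHS](trmxK v) -trmx_mul [RHS]mxE.
have q0 : 0 <= q := psdmx_form v pX.
have XvE : X *m v = \sum_(w <- s) (w^T *m v) 0 0 *: w.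
  rewrite {1}sE mulmx_suml; apply: eq_bigr => w _.
  by rewrite -mulmxA {1}[w^T *m v]mx11_scalar mul_mx_scalar.
have le_q w : w \in s -> ((w^T *m v) 0 0) ^+ 2 <= q.
  move=> ws; rewrite qE (big_rem w ws) /= lerDl sumr_ge0// => u _.
  by rewrite sqr_ge0.
have -> : bform Z (X *m v) (X *m v) =
   \sum_(w <- s) \sum_(u <- s) (w^T *m v) 0 0 * (u^T *m v) 0 0 * bform Z w u.
  rewrite XvE /bform [(\sum_(w <- s) _)^T]linear_sum /= !mulmx_suml summxE.
  apply: eq_bigr => w _.
  rewrite mulmx_sumr summxE; apply: eq_bigr => u _.
  by rewrite -/(bform _ _ _) bformZl bformZr mulrA.
apply: (@le_trans _ _ (q * \sum_(w <- s) \sum_(u <- s) `|bform Z w u|)).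
  apply: le_trans (ler_norm_sum _ _ _) _; rewrite mulr_sumr.
  rewrite big_seq [leRHS]big_seq; apply: ler_sum => w ws.
  apply: le_trans (ler_norm_sum _ _ _) _; rewrite mulr_sumr.
  rewrite big_seq [leRHS]big_seq; apply: ler_sum => u us.
  rewrite normrM ler_wpM2r//; have := le_q _ ws; have := le_q _ us.
  set x := (w^T *m v) 0 0; set y := (u^T *m v) 0 0 => yq xq.
  by rewrite ler_norml; apply/andP; split; nra.
by rewrite mulrC ler_wpM2r// lerDr.
Qed.

(** Inclusion of the ranges gives [Y = X^T Z X] with [Z] built from the pseudo-inverse, so the form
    of [Y] is dominated by that of [X]. Both signs of [t] are allowed: [X] can be moved back and
    forth inside its face of the cone. *)
Lemma psdmx_perturb X Y : psdmx X -> symmx Y -> (Y <= X)%MS ->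
  exists2 c, 0 < c & forall t, `|t| <= c -> psdmx (X + t *: Y).
Proof.
move=> pX sY YX; have [sX _] := pX.
pose Z := (pinvmx X)^T *m Y *m pinvmx X.
have YE : Y = X^T *m Z *m X.
  have YK : Y *m pinvmx X *m X = Y := mulmxKpV YX.
  have KY : (pinvmx X *m X)^T *m Y = Y by rewrite -{1}sY -trmx_mul mulmxA YK sY.
  rewrite /Z; move: (pinvmx X) YK KY => K YK KY.
  by rewrite !mulmxA -trmx_mul KY YK.
have [c c0 dom] := psdmx_conj_dominated Z pX.
exists c^-1 => [|t tc]; first by rewrite invr_gt0.
split=> [|v]; first by apply: symmxD => //; exact: symmxZ.
rewrite -/(bform _ _ _) bformD bformZ {1}YE -bform_mul.
have := dom v; set x := bform Z _ _; have := psdmx_form v pX.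
set q := bform X v v => q0 xq.
have : `|t * x| <= q.
  rewrite normrM; apply: le_trans (ler_pM _ _ tc xq) _ => //.
  by rewrite mulKf// gt_eqF.
by rewrite ler_norml => /andP[]; lra.
Qed.

Lemma pdmx_perturb X Y : pdmx X -> symmx Y ->
  exists2 c, 0 < c & forall t, `|t| <= c -> psdmx (X + t *: Y).
Proof.
move=> pX sY; apply: psdmx_perturb => //; first exact: pdmx_psd.
by rewrite submx_full// row_full_unit pdmx_unit.
Qed.

Lemma pdmx1 : pdmx (1%:M : 'M[R]_n).
Proof.
apply: pdmxE => [|v]; last by rewrite mul1mx.
by have := psdmx_gram (1%:M : 'M[R]_n); rewrite trmx1 mul1mx.
Qed.

(** Some [S - c I] is still semidefinite and pairs non-negatively with [X]. As the trace bounds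
    every entry of [X], a definite matrix turns bounds on [inner S X] into compactness. *)
Lemma inner_pd_ge_trace S : pdmx S ->
  exists2 c, 0 < c & forall X, psdmx X -> c * \tr X <= inner S X.
Proof.
move=> pS; have [c c0 pc] := pdmx_perturb pS symmx1.
exists c => // X pX; have pSc := pc (- c); rewrite normrN gtr0_norm// in pSc.
have := inner_psd_ge0 (pSc (lexx _)) pX.
by rewrite innerDl innerZl inner1l mulNr subr_ge0.
Qed.

Lemma inner_le_trace Y : symmx Y ->
  exists2 c, 0 < c & forall X, psdmx X -> `|inner Y X| <= c * \tr X.
Proof.
move=> sY; have [c c0 pc] := pdmx_perturb pdmx1 sY.
exists c^-1 => [|X pX]; first by rewrite invr_gt0.
have := inner_psd_ge0 (pc c _) pX; have := inner_psd_ge0 (pc (- c) _) pX.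
rewrite normrN gtr0_norm// lexx => /(_ isT) h1 /(_ isT) h2; move: h1 h2.
rewrite !innerDl !innerZl inner1l mulNr => h1 h2.
by rewrite mulrC ler_pdivlMr// mulrC -{1}(gtr0_norm c0) -normrM ler_norml; lra.
Qed.

Lemma psdmx_trace_ge0 X : psdmx X -> 0 <= \tr X.
Proof. by move=> pX; rewrite -inner1l inner_psd_ge0//; exact/pdmx_psd/pdmx1. Qed.

Lemma bform_delta X i j : bform X (delta_mx i 0) (delta_mx j 0) = X i j.
Proof. by rewrite /bform trmx_delta -rowE -colE !mxE. Qed.

Lemma psdmx_entry_le X i j : psdmx X -> `|X i j| <= \tr X.
Proof.
move=> pX; have t0 := psdmx_trace_ge0 pX.
have d0 k : 0 <= X k k by rewrite -bform_delta psdmx_form.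
have dt k : X k k <= \tr X.
  by rewrite /mxtrace (bigD1 k)//= lerDl sumr_ge0.
have := psdmx_CauchySchwarz (delta_mx i 0) (delta_mx j 0) pX.
rewrite !bform_delta => cs; rewrite -(ger0_norm t0) -ler_sqr ?nnegrE//.
rewrite !real_normK ?num_real//; apply: le_trans cs _.
by rewrite expr2 ler_pM.
Qed.

End QuadraticForms.

(** * Continuity of matrix-valued functions and compactness of sets of matrices *)

Section MatrixContinuity.
Variables (R : realType).

(** Entrywise, so that products, traces and determinants reduce to sums and products of real
    functions, whatever the matrix sizes. *)
Definition entry_continuous (T : topologicalType) m n (A : T -> 'M[R]_(m, n)) :=
  forall i j, continuous (fun x => A x i j : R).

Lemma entry_continuousP (T : topologicalType) m n (A : T -> 'M[R]_(m, n)) :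
  entry_continuous A -> continuous A.
Proof.
move=> cA x B [P AP sPB]; apply: (@filterS _ _ _ [set y | forall i j, P i j (A y i j)]).
  by move=> y; apply: sPB.
apply: filter_forall => i; apply: filter_forall => j.
exact: (cA i j x _ (AP i j)).
Qed.

Section Operations.
Variable T : topologicalType.

Lemma entry_continuous_id m n : entry_continuous (@id 'M[R]_(m, n)).
Proof. by move=> i j; exact: coord_continuous. Qed.

Lemma entry_continuous_cst m n (A : 'M[R]_(m, n)) :
  entry_continuous (fun _ : T => A).
Proof. by move=> i j; exact: cst_continuous. Qed.

Lemma continuous_sumr (I : Type) (r : seq I) (F : I -> T -> R) :
  (forall i, continuous (F i)) -> continuous (fun x => \sum_(i <- r) F i x).
Proof.
move=> cF; apply: continuous_big => //.
exact: add_continuous.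
Qed.

Lemma continuous_prodr (I : Type) (r : seq I) (F : I -> T -> R) :
  (forall i, continuous (F i)) -> continuous (fun x => \prod_(i <- r) F i x).
Proof.
move=> cF; apply: continuous_big => //.
exact: mul_continuous.
Qed.

Lemma continuous_addr (f g : T -> R) :
  continuous f -> continuous g -> continuous (fun x => f x + g x).
Proof. by move=> cf cg x; apply: cvgD; [exact: cf|exact: cg]. Qed.

Lemma continuous_mulr (f g : T -> R) :
  continuous f -> continuous g -> continuous (fun x => f x * g x).
Proof. by move=> cf cg x; apply: cvgM; [exact: cf|exact: cg]. Qed.

Lemma entry_continuousD m n (A B : T -> 'M[R]_(m, n)) :
  entry_continuous A -> entry_continuous B ->
  entry_continuous (fun x => A x + B x).
Proof.
move=> cA cB i j; under eq_fun do rewrite mxE.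
exact: continuous_addr.
Qed.

Lemma entry_continuousZ m n a (A : T -> 'M[R]_(m, n)) :
  entry_continuous A -> entry_continuous (fun x => a *: A x).
Proof.
move=> cA i j; under eq_fun do rewrite mxE.
by apply: continuous_mulr => //; exact: cst_continuous.
Qed.

Lemma entry_continuousB m n (A B : T -> 'M[R]_(m, n)) :
  entry_continuous A -> entry_continuous B ->
  entry_continuous (fun x => A x - B x).
Proof.
move=> cA cB; under eq_fun do rewrite -scaleN1r.
by apply: entry_continuousD => //; exact: entry_continuousZ.
Qed.

Lemma entry_continuousM m n p (A : T -> 'M[R]_(m, n)) (B : T -> 'M[R]_(n, p)) :
  entry_continuous A -> entry_continuous B ->
  entry_continuous (fun x => A x *m B x).
Proof.
move=> cA cB i j; under eq_fun do rewrite mxE.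
by apply: continuous_sumr => k; exact: continuous_mulr.
Qed.

Lemma entry_continuousT m n (A : T -> 'M[R]_(m, n)) :
  entry_continuous A -> entry_continuous (fun x => (A x)^T).
Proof. by move=> cA i j; under eq_fun do rewrite mxE; exact: cA. Qed.

Lemma continuous_mxtrace n (A : T -> 'M[R]_n) :
  entry_continuous A -> continuous (fun x => \tr (A x)).
Proof. by move=> cA; apply: continuous_sumr => i; exact: cA. Qed.

Lemma continuous_det n (A : T -> 'M[R]_n) :
  entry_continuous A -> continuous (fun x => \det (A x)).
Proof.
move=> cA; apply: continuous_sumr => s; apply: continuous_mulr.
  exact: cst_continuous.
by apply: continuous_prodr => i; exact: cA.
Qed.

Lemma continuous_inner n (A B : T -> 'M[R]_n) :
  entry_continuous A -> entry_continuous B ->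
  continuous (fun x => inner (A x) (B x)).
Proof. by move=> cA cB; apply: continuous_mxtrace; exact: entry_continuousM. Qed.

Lemma entry_continuous_svec n (A : T -> 'M[R]_n) :
  entry_continuous A -> entry_continuous (fun x => svec (A x)).
Proof.
move=> cA i j; pose p := val (enum_val i : upper n).
case E : (p.1 == p.2); under eq_fun do rewrite mxE /= E; first exact: cA.
by apply: continuous_mulr; [exact: cst_continuous|exact: cA].
Qed.

Lemma closed_psdmx n (A : T -> 'M[R]_n) :
  entry_continuous A -> closed [set x | psdmx (A x)].
Proof.
move=> cA.
have -> : [set x : T | psdmx (A x)] =
    (\bigcap_(ij in [set: 'I_n * 'I_n])
       [set x : T | (A x - (A x)^T) ij.1 ij.2 = 0]) `&`
    \bigcap_(v in [set: 'cV[R]_n]) [set x : T | 0 <= (v^T *m A x *m v) 0 0].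
  apply/seteqP; split=> x /= [h1 h2]; split.
  - by move=> ij _; rewrite /= h1 subrr mxE.
  - by move=> v _; exact: h2.
  - apply/matrixP => i j; have /eqP := h1 (i, j) I.
    by rewrite !mxE subr_eq0 => /eqP.
  - by move=> v; exact: h2.
apply: closedI; apply: closed_bigI.
- move=> ij _; apply: (@preimage_closed _ _ (fun x => (A x - (A x)^T) ij.1 ij.2)
    [set x | x = 0]); last exact: closed_eq.
  by move=> x _; apply: entry_continuousB => //; exact: entry_continuousT.
- move=> v _; apply: (@preimage_closed _ _ (fun x => (v^T *m A x *m v) 0 0)
    [set x | 0 <= x]); last exact: closed_ge.
  move=> x _; apply: entry_continuousM; last exact: entry_continuous_cst.
  by apply: entry_continuousM => //; exact: entry_continuous_cst.
Qed.

Lemma closed_continuous_eq (f : T -> R) a :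
  continuous f -> closed [set x | f x = a].
Proof.
move=> cf; apply: (@preimage_closed _ _ f [set x | x = a]); last exact: closed_eq.
by move=> x _; exact: cf.
Qed.

Lemma closed_continuous_le (f : T -> R) a :
  continuous f -> closed [set x | f x <= a].
Proof.
move=> cf; apply: (@preimage_closed _ _ f [set x | x <= a]); last exact: closed_le.
by move=> x _; exact: cf.
Qed.

End Operations.

(** [K] is the image under [vec_mx] of a closed part of a box of row vectors, which is compact as a
    product of segments. *)
Lemma mx_bounded_closed_compact m n (K : set 'M[R]_(m, n)) (M : R) :
  closed K -> (forall X, K X -> forall i j, `|X i j| <= M) -> compact K.
Proof.
move=> cK bK; pose B := [set v : 'rV[R]_(m * n) | forall k, `|v 0 k| <= M].
have -> : K = vec_mx @` ((@vec_mx R m n) @^-1` K `&` B).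
  apply/seteqP; split=> [X KX|_ [v [Kv _] <-]//].
  exists (mxvec X); last exact: mxvecK.
  split=> [|k]; first by rewrite /= mxvecK.
  by case/mxvec_indexP: k => i j; rewrite mxvecE; exact: bK.
have cvec : continuous (@vec_mx R m n).
  apply: entry_continuousP => i j; under eq_fun do rewrite mxE.
  exact: coord_continuous.
apply: continuous_compact; first exact: continuous_subspaceT.
have cB : compact B.
  have -> : B = [set v | forall k, `[- M, M]%classic (v ord0 k)].
    by apply/seteqP; split=> v Bv k; have := Bv k; rewrite /= in_itv /= ler_norml.
  apply: (@rV_compact R _ (fun=> `[- M, M]%classic)) => _.
  exact: segment_compact.
apply: (subclosed_compact _ cB) => [|v []//]; apply: closedI.
  exact: (proj1 (continuous_closedP _) cvec).
exact: compact_closed (@norm_hausdorff _ _) cB.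
Qed.

Lemma mx_bounded_closed_min m n (K : set 'M[R]_(m, n)) (M : R)
    (f : 'M[R]_(m, n) -> R) :
  closed K -> (forall X, K X -> forall i j, `|X i j| <= M) -> K !=set0 ->
  continuous f -> exists2 X, K X & forall Y, K Y -> f X <= f Y.
Proof.
move=> cK bK K0 cf.
have wcf : {within K, continuous f} by exact: continuous_subspaceT.
have [X XK minX] := compact_EVT_min K0 (mx_bounded_closed_compact cK bK) wcf.
by exists X => [|Y YK]; [exact: set_mem|apply: minX; exact: mem_set].
Qed.

End MatrixContinuity.

(** * Weak and strong duality for a fixed parameter *)

Lemma quadratic_slope_ge0 (R : realFieldType) (g h : R) :
  (forall t, 0 < t <= 1 -> 0 <= t * g + t ^+ 2 * h) -> 0 <= g.
Proof.
move=> gh; rewrite leNgt; apply/negP => g0.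
have den0 : 0 < `|g| + `|h| + 1 by rewrite ltr_wpDl// addr_ge0.
(* Small enough that [t * |h| <= |g| / 2], so that a negative linear term would win. *)
pose t := `|g| / (`|g| + `|h| + 1) / 2.
have g0' : 0 < `|g| by rewrite normr_gt0 lt_eqF.
have t0 : 0 < t by rewrite !divr_gt0.
have tE : t * 2 * (`|g| + `|h| + 1) = `|g|.
  by rewrite /t divfK ?pnatr_eq0// divfK// gt_eqF.
have h0 : 0 <= `|h| by [].
have t1 : t <= 1 by nra.
have := gh t; rewrite t0 t1 => /(_ isT).
rewrite expr2 -mulrA -mulrDr pmulr_rge0// => gth.
have hh : h <= `|h| := ler_norm h.
have gN : `|g| = - g by rewrite ltr0_norm.
by rewrite gN in tE g0'; nra.
Qed.

Lemma ler_norm_sqr1 (R : realFieldType) (x c : R) : x ^+ 2 <= c -> `|x| <= 1 + c.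
Proof. by move=> xc; rewrite ler_norml; apply/andP; split; nra. Qed.

Section Duality.
Variables (R : realType) (n m : nat) (P : param_sdp R n m).
Hypothesis hsym : symmetric_data P.
Implicit Types (X S : 'M[R]_n) (y : 'cV[R]_m) (e : R).

Local Notation A := (constr P).
Local Notation b := (fun i => rhs P i 0).

Definition adjoint y : 'M[R]_n := \sum_i y i 0 *: A i.

Lemma adjoint_linear a y z : adjoint (a *: y + z) = a *: adjoint y + adjoint z.
Proof.
rewrite /adjoint scaler_sumr -big_split; apply: eq_bigr => i _ /=.
by rewrite !mxE scalerDl scalerA.
Qed.

Lemma inner_adjoint y X : inner (adjoint y) X = \sum_i y i 0 * inner (A i) X.
Proof. by rewrite inner_suml; apply: eq_bigr => i _; rewrite innerZl. Qed.

Lemma dual_objectiveE y : dual_objective P y = \sum_i y i 0 * b i.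
Proof. by rewrite /dual_objective mxE; apply: eq_bigr => i _; rewrite mxE mulrC. Qed.

Lemma inner_adjoint_feasible y X : primal_feasible P X ->
  inner (adjoint y) X = dual_objective P y.
Proof.
move=> [AX _]; rewrite inner_adjoint dual_objectiveE.
by apply: eq_bigr => i _; rewrite AX.
Qed.

Lemma symmx_cost_at e : symmx (cost_at P e).
Proof. by case: hsym => sC sD _; apply: symmxD => //; exact: symmxZ. Qed.

Lemma cost_atD e d : cost_at P (e + d) = cost_at P e + d *: dcost P.
Proof. by rewrite /cost_at scalerDl addrA. Qed.

Lemma duality_gap e X y S : primal_feasible P X -> dual_feasible P e (y, S) ->
  inner (cost_at P e) X - dual_objective P y = inner S X.
Proof.
move=> pX [<- _] /=; rewrite innerDl -/(adjoint y) inner_adjoint_feasible//.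
by rewrite addrC addKr.
Qed.

(** The gap between the objectives of a feasible pair is [inner S X], never negative. Every new
    optimal pair constructed below is certified in this way. *)
Lemma optimal_of_complementary e X y S :
  primal_feasible P X -> dual_feasible P e (y, S) -> inner S X = 0 ->
  primal_optimal P e X /\ dual_optimal P e (y, S).
Proof.
move=> pX dS SX0; have := duality_gap pX dS; rewrite SX0 => gap0.
split; split=> //.
  move=> X' pX'; have := duality_gap pX' dS.
  by have := inner_psd_ge0 dS.2 pX'.2 => /=; lra.
move=> [y' S'] dS' /=; have := duality_gap pX dS'.
by have := inner_psd_ge0 dS'.2 pX.2 => /=; lra.
Qed.

Section StrongDuality.
Variables (e : R) (X0 S0 Xo : 'M[R]_n) (y0 : 'cV[R]_m).
Hypotheses (pX0 : primal_feasible P X0) (pdX0 : pdmx X0)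
  (dS0 : dual_feasible P e (y0, S0)) (pdS0 : pdmx S0)
  (oXo : primal_optimal P e Xo).

Local Notation C := (cost_at P e).

Section Penalty.
Variable w : R.

(** Squared distance from [(b, w)] to the image of [X] under the constraint functionals and the
    cost. Minimising it over the semidefinite cone projects [(b, w)] onto the image cone and so
    produces a separating functional; [w] is later taken below the optimal value. *)
Definition penalty X : R :=
  \sum_i (inner (A i) X - b i) ^+ 2 + (inner C X - w) ^+ 2.

Lemma penalty_continuous : continuous penalty.
Proof.
have sq (f : 'M[R]_n -> R) (a : R) :
    continuous f -> continuous (fun X => (f X - a) ^+ 2).
  move=> cf; under eq_fun do rewrite expr2.
  have cfa : continuous (fun X => f X - a).
    by apply: continuous_addr => //; exact: cst_continuous.
  exact: continuous_mulr.
have lin (Y : 'M[R]_n) : continuous (fun X => inner Y X).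
  by apply: continuous_inner; [exact: entry_continuous_cst|exact: entry_continuous_id].
apply: continuous_addr; last exact: sq.
by apply: continuous_sumr => i; exact: sq.
Qed.

(** A penalty of at most that of [X0] bounds [inner C X] and every [inner (A i) X], hence also
    [inner S0 X], which combines them through the dual equation; definiteness of [S0] then bounds
    the trace, so the sublevel set is compact. *)
Lemma penalty_min : exists2 X, psdmx X & forall Y, psdmx Y -> penalty X <= penalty Y.
Proof.
pose F := penalty X0; pose K := [set X | psdmx X] `&` [set X | penalty X <= F].
have [c c0 trS0] := inner_pd_ge_trace pdS0.
have K0 : K X0 by split; [exact: pX0.2|exact: lexx].
have cK : closed K.
  apply: closedI; first exact: (closed_psdmx (@entry_continuous_id _ _ _)).
  apply: closed_continuous_le; exact: penalty_continuous.
pose B := `|w| + (1 + F) + \sum_i `|y0 i 0| * (`|b i| + (1 + F)).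
have bK X : K X -> forall i j, `|X i j| <= B / c.
  move=> [pX XF] i j; apply: le_trans (psdmx_entry_le i j pX) _.
  rewrite ler_pdivlMr// mulrC; apply: le_trans (trS0 _ pX) _.
  have sq_le k : (inner (A k) X - b k) ^+ 2 <= F.
    apply: le_trans XF; rewrite /penalty (bigD1 k)//= -addrA lerDl addr_ge0 ?sqr_ge0//.
    by apply: sumr_ge0 => l _; rewrite sqr_ge0.
  have sqC_le : (inner C X - w) ^+ 2 <= F.
    apply: le_trans XF; rewrite /penalty lerDr.
    by apply: sumr_ge0 => l _; rewrite sqr_ge0.
  have -> : inner S0 X = inner C X - inner (adjoint y0) X.
    by rewrite -dS0.1 innerDl /= addrC addKr.
  rewrite /B lerD//.
    have := ler_norm_sqr1 sqC_le; have := ler_norm w; rewrite ler_norml.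
    by move=> ? /andP[_ ?]; lra.
  rewrite inner_adjoint -sumrN; apply: ler_sum => k _.
  apply: le_trans (ler_norm _) _; rewrite normrN normrM ler_wpM2l//.
  have -> : inner (A k) X = b k + (inner (A k) X - b k) by rewrite addrC subrK.
  by apply: le_trans (ler_normD _ _) _; rewrite lerD2l; exact: ler_norm_sqr1.
have [X KX minX] := mx_bounded_closed_min cK bK (ex_intro _ _ K0) penalty_continuous.
exists X => [|Y pY]; first exact: KX.1.
by have [YF|/ltW] := leP (penalty Y) F; [exact: minX|apply: le_trans; exact: minX].
Qed.

(** Half the gradient of the penalty. *)
Definition penalty_grad X : 'M[R]_n :=
  adjoint (\col_i (inner (A i) X - b i)) + (inner C X - w) *: C.

Lemma penaltyD X Z t : penalty (X + t *: Z) = penalty X +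
  (t * (2 * inner (penalty_grad X) Z) +
   t ^+ 2 * (\sum_i inner (A i) Z ^+ 2 + inner C Z ^+ 2)).
Proof.
rewrite /penalty /penalty_grad innerDl inner_adjoint innerZl.
set s := \sum_i _; set s1 := \sum_i _; set s2 := \sum_i _; set s3 := \sum_i _.
have -> : s = s1 + t * (2 * s2) + t ^+ 2 * s3.
  rewrite /s /s1 /s2 /s3 !mulr_sumr -!big_split; apply: eq_bigr => i _ /=.
  by rewrite mxE innerDr innerZr; ring.
by rewrite innerDr innerZr; ring.
Qed.

Lemma penalty_grad_ge0 X Z : (forall Y, psdmx Y -> penalty X <= penalty Y) ->
  (forall t, 0 < t <= 1 -> psdmx (X + t *: Z)) ->
  0 <= inner (penalty_grad X) Z.
Proof.
move=> minX pZ; rewrite -(@pmulr_rge0 _ 2)//.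
apply: quadratic_slope_ge0 => t t01; have := minX _ (pZ t t01).
by rewrite penaltyD lerDl; exact.
Qed.

End Penalty.

(* The gradient at a minimiser of the penalty is a positive semidefinite
   combination of the [A i] and [C], orthogonal to the minimiser; primal Slater
   makes the coefficient of [C] positive, and dividing by it gives the dual
   point. *)
Lemma dual_almost_optimal d : 0 < d -> exists z, dual_feasible P e z /\
  inner C Xo - d <= dual_objective P z.1.
Proof.
move=> d0; set w := inner C Xo - d.
have [X pX minX] := penalty_min w.
pose r : 'cV[R]_m := \col_i (inner (A i) X - b i); pose rho := inner C X - w.
pose G := penalty_grad w X.
have [_ _ sA] := hsym.
have sG : symmx G.
  apply: symmxD; last by apply: symmxZ; exact: symmx_cost_at.
  rewrite /symmx /adjoint linear_sum; apply: eq_bigr => i _.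
  by rewrite linearZ /= sA.
have GZ Z : psdmx Z -> 0 <= inner G Z.
  move=> pZ; apply: penalty_grad_ge0 => // t /andP[/ltW t0 _].
  by apply: psdmxD => //; exact: psdmxZ.
have GX : inner G X = 0.
  apply/eqP; rewrite eq_le GZ// andbT -oppr_ge0 -innerNr.
  apply: penalty_grad_ge0 => // t /andP[_ t1].
  have -> : X + t *: - X = (1 - t) *: X by rewrite scalerN scalerBl scale1r.
  by apply: psdmxZ => //; rewrite subr_ge0.
have pG : psdmx G.
  split=> // v; rewrite -/(bform _ _ _) -inner_outer GZ//.
  by have := psdmx_gram v^T; rewrite trmxK.
have GE Z : inner G Z = \sum_i r i 0 * inner (A i) Z + rho * inner C Z.
  by rewrite /G /penalty_grad innerDl inner_adjoint innerZl.
have r2 : 0 <= \sum_i r i 0 ^+ 2 by apply: sumr_ge0 => i _; rewrite sqr_ge0.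
have eX : \sum_i r i 0 * inner (A i) X =
    \sum_i r i 0 * b i + \sum_i r i 0 ^+ 2.
  rewrite -big_split; apply: eq_bigr => i _ /=.
  have -> : inner (A i) X = b i + r i 0 by rewrite /r mxE addrC subrK.
  by rewrite mulrDr expr2.
have eX0 : \sum_i r i 0 * inner (A i) X0 = \sum_i r i 0 * b i.
  by apply: eq_bigr => i _; rewrite pX0.1.
have CX : inner C X = w + rho by rewrite /rho addrC subrK.
have c0 : w < inner C X0.
  by have := oXo.2 _ pX0; rewrite /w; lra.
have G0 := GZ _ pX0.2; rewrite GE eX0 in G0; rewrite GE eX CX in GX.
(* [G0] minus [GX] reads [rho * (inner C X0 - w) >= \sum_i r i 0 ^+ 2 + rho ^+ 2], with a positive
   bracket by [c0]. So [rho <= 0] would make [X] feasible with cost [w], below the optimal value. *)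
have rho0 : 0 < rho.
  rewrite ltNge; apply/negP => rho0.
  have rho_eq0 : rho = 0 by nra.
  have r_eq0 : \sum_i r i 0 ^+ 2 = 0 by nra.
  have pfX : primal_feasible P X.
    split=> // i; move/eqP: r_eq0; rewrite psumr_eq0; last first.
      by move=> j _; rewrite sqr_ge0.
    move=> /allP/(_ i (mem_index_enum _)) /=.
    by rewrite sqrf_eq0 mxE subr_eq0 => /eqP.
  by have := oXo.2 _ pfX; rewrite CX rho_eq0 addr0 /w; lra.
exists (- rho^-1 *: r, rho^-1 *: G); split.
  split=> /=; last by apply: psdmxZ => //; rewrite invr_ge0 ltW.
  have := adjoint_linear (- rho^-1) r 0; rewrite addr0 -/(adjoint _) => ->.
  have -> : adjoint 0 = 0 by rewrite /adjoint big1// => i _; rewrite mxE scale0r.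
  rewrite addr0 /G /penalty_grad -/r -/rho scalerDr scalerA mulVf ?gt_eqF//.
  by rewrite scale1r scaleNr addrA addNr add0r.
rewrite dual_objectiveE /=.
have -> : \sum_i (- rho^-1 *: r) i 0 * b i = - rho^-1 * \sum_i r i 0 * b i.
  by rewrite mulr_sumr; apply: eq_bigr => i _; rewrite mxE mulrA.
rewrite mulNr -mulrN mulrC ler_pdivlMr//.
by nra.
Qed.

(** Almost optimal dual points suffice: a dual optimum is at least as good as each of them, so its
    gap to [Xo] is below every [d > 0]. *)
Lemma complementary_optimal y S : dual_optimal P e (y, S) -> inner S Xo = 0.
Proof.
move=> [dS oS]; apply/eqP; rewrite eq_le inner_psd_ge0 ?andbT; last 2 first.
- exact: dS.2.
- exact: oXo.1.2.
rewrite -(duality_gap oXo.1 dS) subr_le0; apply/ler_addgt0Pr => d d0.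
have [z [dz zE]] := dual_almost_optimal d0.
by have := oS _ dz => /= h; rewrite -lerBlDr; exact: le_trans zE h.
Qed.

End StrongDuality.

End Duality.

(** * Complementarity of optimal solutions at interior parameters *)

Section SelectedOptima.
Variables (R : realType) (n m : nat) (P : param_sdp R n m).
Variables (Xs : R -> 'M[R]_n) (ys : R -> 'cV[R]_m) (Ss : R -> 'M[R]_n).
Hypotheses (hsym : symmetric_data P) (hint : interior_point_at0 P)
  (hsel : max_complementary_selection P Xs ys Ss).
Implicit Types (e : R).

Lemma selected_primal e : int_params P e -> primal_optimal P e (Xs e).
Proof. by move=> /hsel[[]]. Qed.

Lemma selected_dual e : int_params P e -> dual_optimal P e (ys e, Ss e).
Proof. by move=> /hsel[_ []]. Qed.

Lemma int_params_near e : int_params P e ->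
  exists2 r, 0 < r & forall e', `|e' - e| < r -> int_params P e'.
Proof.
move=> ie; have /nbhs_ballP[r /= r0 rI] := nbhs_interior ie.
by exists r => // e' e'r; apply: rI; rewrite /ball /= distrC.
Qed.

Lemma dual_feasible_affine e1 e2 t (z1 z2 : 'cV[R]_m * 'M[R]_n) :
  dual_feasible P e1 z1 -> dual_feasible P e2 z2 ->
  adjoint P (z1.1 + t *: (z2.1 - z1.1)) + (z1.2 + t *: (z2.2 - z1.2)) =
  cost_at P (e1 + t * (e2 - e1)).
Proof.
move=> [E1 _] [E2 _].
have -> : adjoint P (z1.1 + t *: (z2.1 - z1.1)) =
    adjoint P z1.1 + t *: (adjoint P z2.1 - adjoint P z1.1).
  rewrite [in LHS]addrC adjoint_linear [RHS]addrC -[z2.1 - z1.1]addrC -scaleN1r.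
  by rewrite adjoint_linear scaleN1r [- _ + _]addrC.
rewrite -/(adjoint P _) in E1; rewrite -/(adjoint P _) in E2.
have S1 : z1.2 = cost_at P e1 - adjoint P z1.1 by rewrite -E1 addrC addKr.
have S2 : z2.2 = cost_at P e2 - adjoint P z2.1 by rewrite -E2 addrC addKr.
rewrite S1 S2 cost_atD; have -> : cost_at P e2 = cost_at P e1 + (e2 - e1) *: dcost P.
  by rewrite -cost_atD addrC subrK.
apply/matrixP => i j; rewrite !mxE; ring.
Qed.

(** [e] is a convex combination of [0] and [(1 + h) * e], the latter still an interior parameter
    since [h * |e| < r]. The definite slack at [0] enters with the positive weight [1 - t], so the
    combined slack is definite. *)
Lemma dual_slater e : int_params P e ->
  exists z, dual_feasible P e z /\ pdmx z.2.
Proof.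
move=> ie; have [r r0 rI] := int_params_near ie.
have [_ [y0 [S0 [_ dS0 _ pdS0]]]] := hint.
pose h := r / (2 * (`|e| + 1)).
have h0 : 0 < h by rewrite divr_gt0// mulr_gt0// ltr_wpDl.
have ih : int_params P ((1 + h) * e).
  apply: rI; rewrite mulrDl mul1r addrC addKr normrM gtr0_norm//.
  rewrite /h mulrAC ltr_pdivrMr ?mulr_gt0// ?ltr_wpDl//.
  by have : 0 <= `|e| by []; nra.
have [dS _] := selected_dual ih.
pose t := (1 + h)^-1.
have t0 : 0 < t by rewrite invr_gt0; lra.
have t1 : t < 1 by rewrite invf_lt1; lra.
have := dual_feasible_affine t dS0 dS => /=.
rewrite add0r subr0 mulrA mulVf ?mul1r; last by apply: lt0r_neq0; lra.
set S := S0 + _ => E; have pdS : pdmx S.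
  have -> : S = t *: Ss ((1 + h) * e) + (1 - t) *: S0.
    by apply/matrixP => i j; rewrite !mxE; ring.
  apply: pdmxD_psd; first by apply: psdmxZ; [exact: ltW|exact: dS.2].
  by apply: pdmxZ => //; rewrite subr_gt0.
by eexists (_, S); split=> //; split; [exact: E|exact: pdmx_psd].
Qed.

Lemma optimal_complementary e X y S : int_params P e ->
  primal_optimal P e X -> dual_optimal P e (y, S) -> inner S X = 0.
Proof.
move=> ie oX oS; have [[y1 S1] [dS1 pdS1]] := dual_slater ie.
have [X0 [_ [_ [pX0 _ pdX0 _]]]] := hint.
exact: (complementary_optimal hsym pX0 dS1 pdS1 oX oS).
Qed.

End SelectedOptima.

(** * Symmetric vectorisation and the kernel of the Jacobian *)

Section SymmetricVectorization.
Variables (R : realType) (n : nat).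

Definition smat (h : 'cV[R]_(sdim n)) : 'M[R]_n := \sum_k h k 0 *: sbasis R k.

Lemma symmx_smat h : symmx (smat h).
Proof.
rewrite /symmx linear_sum; apply: eq_bigr => k _; rewrite linearZ /=.
by rewrite symmx_sbasis.
Qed.

Lemma smatK h : svec (smat h) = h.
Proof.
rewrite linear_sum /= [RHS]matrix_sum_delta; apply: eq_bigr => k _.
by rewrite big_ord1 linearZ /= svec_sbasis.
Qed.

Lemma inner_sbasis (Y : 'M[R]_n) k : symmx Y -> inner Y (sbasis R k) = svec Y k 0.
Proof.
move=> sY; have inD i j : inner Y (delta_mx i j) = Y j i.
  rewrite /inner -[delta_mx i j](mul_delta_mx (0 : 'I_1)) mulmxA mxtrace_mulC.
  by rewrite mulmxA -rowE /mxtrace big_ord1 -colE !mxE.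
have s2 : Num.sqrt 2 != 0 :> R by rewrite sqrtr_eq0 -ltNge ltr0n.
rewrite /sbasis mxE /=; case: ifP => [/eqP E|_]; first by rewrite inD E.
rewrite innerZr innerDr !inD.
set i := (val _).1; set j := (val _).2.
have -> : Y j i = Y i j by rewrite -[in LHS]sY mxE.
rewrite -mulr2n -[Y i j *+ 2]mulr_natl mulrA; congr (_ * _).
by apply: (mulfI s2); rewrite mulVKf// -expr2 sqr_sqrtr// ler0n.
Qed.

Lemma inner_svec (Y Z : 'M[R]_n) : symmx Y -> symmx Z ->
  inner Y Z = ((svec Y)^T *m svec Z) 0 0.
Proof.
move=> sY sZ; rewrite [in LHS](svec_sum sZ) innerC inner_suml mxE.
apply: eq_bigr => k _; rewrite innerZl innerC inner_sbasis// [in RHS]mxE.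
by rewrite mulrC.
Qed.

End SymmetricVectorization.

Lemma mulmx_castmx (R : pzRingType) k p q l (E : p = q) (M : 'M[R]_(k, p))
    (V : 'M[R]_(p, l)) :
  castmx (erefl, E) M *m castmx (E, erefl) V = M *m V.
Proof. by case: q / E; rewrite !castmx_id. Qed.

Lemma mulmx_castmxr (R : pzRingType) l k p q (E : p = q) (M : 'M[R]_(k, p))
    (V : 'M[R]_(l, k)) :
  V *m castmx (erefl, E) M = castmx (erefl, E) (V *m M).
Proof. by case: q / E; rewrite !castmx_id. Qed.

Section Jacobian.
(* The unqualified [jacobian] is the one of the analysis library. *)
Local Notation jacobian := Defs.jacobian.
Variables (R : realType) (n m : nat) (P : param_sdp R n m).
Hypothesis hsym : symmetric_data P.
Implicit Types (X S H G : 'M[R]_n) (y : 'cV[R]_m).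

Local Notation A := (constr P).

Lemma constraint_mx_svec H : symmx H ->
  constraint_mx P *m svec H = \col_i inner (A i) H.
Proof.
have [_ _ sA] := hsym => sH; apply/colP => i; rewrite !mxE inner_svec// mxE.
by apply: eq_bigr => k _; rewrite !mxE.
Qed.

Lemma constraint_mx_tr y : (constraint_mx P)^T *m y = svec (adjoint P y).
Proof.
rewrite linear_sum; apply/colP => k; rewrite summxE [LHS]mxE.
by apply: eq_bigr => i _; rewrite linearZ !mxE mulrC.
Qed.

Lemma skron1_svec X H : symmx X -> symmx H ->
  skron X 1%:M *m svec H = 2^-1 *: svec (H *m X + X *m H).
Proof. by move=> sX sH; rewrite skron_svec// sX trmx1 mul1mx mulmx1. Qed.

(** Read through [smat], the blocks of a kernel vector solve the linearised optimality system; the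
    factor [2^-1] of [skron] cancels in the third block row. *)
Lemma jacobian_unit X y S : symmx X -> symmx S ->
  (forall H dy G, symmx H -> symmx G -> (forall i, inner (A i) H = 0) ->
     adjoint P dy + G = 0 -> S *m H + H *m S + (X *m G + G *m X) = 0 ->
     [/\ H = 0, dy = 0 & G = 0]) ->
  jacobian P X y S \in unitmx.
Proof.
move=> sX sS inj; apply: unitmx_ker => v.
rewrite -[v](castmxKV (jacobian_width n m) erefl) /jacobian mulmx_castmx.
set u := castmx _ v.
rewrite -[u]vsubmxK -[usubmx u]vsubmxK.
set h := usubmx (usubmx u); set dy := dsubmx (usubmx u); set g := dsubmx u.
rewrite !mul_col_mx !mul_row_col !mul0mx !addr0 add0r mul1mx.
move=> /eqP; rewrite !col_mx_eq0 => /andP[/andP[/eqP E1 /eqP E2] /eqP E3].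
have [|||] := inj (smat h) dy (smat g) (symmx_smat h) (symmx_smat g).
- move=> i; have := constraint_mx_svec (symmx_smat h).
  by rewrite smatK E1 => /colP/(_ i); rewrite !mxE.
- apply: svec_inj; last 1 first.
  + by rewrite linearD /= smatK -constraint_mx_tr E2 linear0.
  + apply: symmxD; last exact: symmx_smat.
    have [_ _ sA] := hsym; rewrite /symmx linear_sum; apply: eq_bigr => i _.
    by rewrite linearZ /= sA.
  + by rewrite /symmx trmx0.
- apply: svec_inj.
  + rewrite /symmx !linearD /= !trmx_mul !symmx_smat sX sS.
    by rewrite [_ *m S + _]addrC [_ *m X + _]addrC.
  + by rewrite /symmx trmx0.
  + move: E3; rewrite -(smatK h) -(smatK g) !skron1_svec ?smatK//; last 2 first.
    * exact: symmx_smat.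
    * exact: symmx_smat.
    move=> /eqP; rewrite -scalerDr scaler_eq0 invr_eq0 pnatr_eq0 /= => /eqP E.
    by rewrite linear0 -E -linearD; congr (svec (_ + _)); exact: addrC.
move=> h0 -> g0.
have -> : h = 0 by rewrite -(smatK h) h0 linear0.
have -> : g = 0 by rewrite -(smatK g) g0 linear0.
by rewrite !col_mx0 castmx_const.
Qed.

(** A common kernel vector [v] of [X] and [S] gives a left null vector: the row [u] representing
    [H |-> v^T H v], placed in the third block, annihilates both [skron] blocks because
    [v^T (Z H + H Z) v = 0]. Invertibility gives [u = 0], and [H = I] then gives [v = 0]. *)
Lemma jacobian_strict X y S : psdmx X -> psdmx S ->
  jacobian P X y S \in unitmx -> pdmx (X + S).
Proof.
move=> pX pS Junit; have [sX _] := pX; have [sS _] := pS.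
apply: pdmxE => [|v XSv]; first exact: psdmxD.
have [Xv Sv] := psdmxD_ker pX pS XSv.
pose u : 'rV[R]_(sdim n) := \row_k bform (sbasis R k) v v.
have uE H : symmx H -> u *m svec H = (bform H v v)%:M.
  move=> sH; apply/matrixP => i j; rewrite !ord1 [RHS]mxE eqxx mulr1n.
  rewrite mxE [in RHS](svec_sum sH) /bform mulmx_sumr mulmx_suml summxE.
  apply: eq_bigr => k _; rewrite -/(bform _ _ _) bformZ mxE mulrC //.
have u0 Z : symmx Z -> Z *m v = 0 -> u *m skron Z 1%:M = 0.
  move=> sZ Zv; apply/rowP => l.
  have : u *m skron Z 1%:M *m svec (sbasis R l) = 0.
    have sB := symmx_sbasis R l.
    rewrite -mulmxA skron1_svec// -scalemxAr uE; last first.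
      by rewrite /symmx linearD /= !trmx_mul sZ sB addrC.
    rewrite bformD /bform -!mulmxA Zv !mulmx0 mulmxA.
    have -> : v^T *m Z = 0 by rewrite -[LHS]trmxK trmx_mul trmxK sZ Zv trmx0.
    by rewrite mul0mx mxE addr0 raddf0 scaler0.
  by rewrite svec_sbasis -colE => /colP/(_ 0); rewrite !mxE.
have : row_mx (row_mx 0 0) u *m jacobian P X y S = 0.
  rewrite /jacobian mulmx_castmxr !mul_row_col !mul0mx !add0r.
  by rewrite !mul_mx_row mulmx0 !u0// row_mx0 row_mx0 castmx_const.
move=> /(congr1 (fun M => M *m invmx (jacobian P X y S))).
rewrite mulmxK// mul0mx => /eqP; rewrite row_mx_eq0 => /andP[_ /eqP u_0].
have := uE 1%:M (symmx1 _ _); rewrite u_0 mul0mx => /matrixP/(_ 0 0).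
rewrite !mxE /= mulr1n /bform mulmx1 => /esym; exact: sqnorm_eq0.
Qed.

End Jacobian.

(** * Linearised complementarity at strictly complementary pairs *)

Section StrictComplementarity.
Variables (R : realType) (n : nat).
Implicit Types (X S H G : 'M[R]_n).

Lemma symmx_mul0C X S : symmx X -> symmx S -> X *m S = 0 -> S *m X = 0.
Proof. by move=> sX sS XS; rewrite -[LHS]trmxK trmx_mul sX sS XS trmx0. Qed.

(** Multiplying the equation by [X] on both sides leaves [X M + M X = 0] for [M = X G X]. Its trace
    against [M] shows that [X] and [M M^T] are orthogonal semidefinite matrices, so [X M = 0], and
    then [M M = X G (X M) = 0]. *)
Lemma linearized_complementarity_sandwich X S H G :
  psdmx X -> symmx S -> symmx G -> X *m S = 0 ->
  S *m H + H *m S + (X *m G + G *m X) = 0 -> X *m G *m X = 0.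
Proof.
move=> pX sS sG XS E; have [sX _] := pX; have SX := symmx_mul0C sX sS XS.
set M := X *m G *m X; have sM : symmx M by rewrite /symmx !trmx_mul sX sG mulmxA.
have XM : X *m M + M *m X = 0.
  have := congr1 (fun Z => X *m Z *m X) E; rewrite mulmx0 mul0mx => <-.
  rewrite !mulmxDr !mulmxDl !mulmxA XS !mul0mx add0r.
  by rewrite -[_ *m S *m X]mulmxA SX mulmx0 add0r.
have XMM : X *m (M *m M^T) = 0.
  apply: inner_psd_eq0 => //; first by have := psdmx_gram M^T; rewrite trmxK.
  have := congr1 (fun Z => \tr (Z *m M)) XM; rewrite mul0mx mxtrace0 mulmxDl.
  rewrite mxtraceD -[M *m X *m M]mulmxA [\tr (M *m _)]mxtrace_mulC -mulmxA.
  by rewrite /inner sM => h; lra.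
have {}XM : X *m M = 0.
  apply: trmx_inj; rewrite trmx0; apply: trmul_eq0.
  by rewrite trmxK trmx_mul mulmxA -[X *m M *m M^T]mulmxA XMM mul0mx.
apply: trmul_eq0; rewrite -/M sM {1}/M -!mulmxA [X *m M]XM !mulmx0 //.
Qed.

(* With [Q = X + S], [p = Q^-1 X] and [q = Q^-1 S] are complementary orthogonal
   projections onto the column spaces of [X] and [S]. The equation gives
   [p G p = 0], [q H q = 0] and [p G q = - Q^-1 (p H q) Q], so
   [inner G H = 0] forces [p H q = 0]. *)
Lemma strict_complementary_kernel X S H G :
  psdmx X -> psdmx S -> symmx H -> symmx G -> X *m S = 0 -> pdmx (X + S) ->
  S *m H + H *m S + (X *m G + G *m X) = 0 -> inner G H = 0 ->
  [/\ H *m S = 0, G *m X = 0, (H <= X)%MS & (G <= S)%MS].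
Proof.
move=> pX pS sH sG XS pQ E GH0; have [sX _] := pX; have [sS _] := pS.
have SX := symmx_mul0C sX sS XS.
have XGX := linearized_complementarity_sandwich pX sS sG XS E.
have SHS : S *m H *m S = 0.
  by apply: (linearized_complementarity_sandwich pS sX sH SX (H := G)); rewrite addrC.
have [Q QD] : exists Q, Q = X + S by exists (X + S).
rewrite -QD in pQ; have uQ := pdmx_unit pQ; have [sQ _] := pQ.
pose Qi := invmx Q; have sQi : symmx Qi by rewrite /symmx trmx_inv sQ.
have QQi : Q *m Qi = 1%:M := mulmxV uQ.
have QiQ : Qi *m Q = 1%:M := mulVmx uQ.
clearbody Qi.
have [p pD] : exists p, p = Qi *m X by exists (Qi *m X).
have [q qD] : exists q, q = Qi *m S by exists (Qi *m S).
have pq : p + q = 1%:M by rewrite pD qD -mulmxDr -QD QiQ.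
have XQ : X *m Q = Q *m X by rewrite QD mulmxDr mulmxDl XS SX.
have SQ : S *m Q = Q *m S by rewrite QD mulmxDr mulmxDl XS SX.
have comm Z : Z *m Q = Q *m Z -> Z *m Qi = Qi *m Z.
  move=> ZQ; rewrite -[LHS]mul1mx -QiQ -!mulmxA [Q *m _]mulmxA -ZQ -!mulmxA.
  by rewrite QQi mulmx1.
have pE : p = X *m Qi by rewrite comm.
have qE : q = S *m Qi by rewrite comm.
have Qp : Q *m p = X by rewrite pD mulmxA QQi mul1mx.
have pQE : p *m Q = X by rewrite pE -mulmxA QiQ mulmx1.
have qQ : q *m Q = S by rewrite qE -mulmxA QiQ mulmx1.
have Qq : Q *m q = S by rewrite qD mulmxA QQi mul1mx.
have sp : p^T = p by rewrite {1}pD trmx_mul sX sQi -pE.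
have sq : q^T = q by rewrite {1}qD trmx_mul sS sQi -qE.
have pp : p *m p = p.
  have pq0 : p *m q = 0 by rewrite pD qE mulmxA -(mulmxA Qi) XS mulmx0 mul0mx.
  by rewrite -[RHS]mulmx1 -pq mulmxDr pq0 addr0.
have qq : q *m q = q.
  have qp0 : q *m p = 0 by rewrite qD pE mulmxA -(mulmxA Qi) SX mulmx0 mul0mx.
  by rewrite -[RHS]mulmx1 -pq mulmxDr qp0 add0r.
have pGp : p *m G *m p = 0.
  by rewrite {1}pD pE !mulmxA -2!(mulmxA Qi) XGX mulmx0 mul0mx.
have qHq : q *m H *m q = 0.
  by rewrite {1}qD qE !mulmxA -2!(mulmxA Qi) SHS mulmx0 mul0mx.
pose K := p *m H *m q; pose L := p *m G *m q.
have KL : K *m Q = - (Q *m L).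
  have : X *m H *m S *m S + X *m X *m G *m S = 0.
    have := congr1 (fun Z => X *m Z *m S) E; rewrite mulmx0 mul0mx => <-.
    rewrite !mulmxDr !mulmxDl !mulmxA XS !mul0mx add0r.
    by rewrite -[X *m G *m X *m S]mulmxA XS mulmx0 addr0.
  have -> : X *m H *m S *m S + X *m X *m G *m S = Q *m (K *m Q + Q *m L) *m Q.
    rewrite !mulmxDr !mulmxDl; congr (_ + _).
      have SS : S *m S = S *m Q by rewrite QD mulmxDr SX add0r.
      by rewrite -(mulmxA (X *m H)) SS -{1}Qp -{1}qQ /K !mulmxA.
    have -> : X *m X = Q *m X by rewrite QD mulmxDl SX addr0.
    by rewrite -{1}Qp -{1}qQ /L !mulmxA.
  move=> /(congr1 (fun Z => Qi *m Z *m Qi)); rewrite mulmx0 mul0mx !mulmxA QiQ.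
  by rewrite mul1mx -mulmxA QQi mulmx1 => /eqP; rewrite addr_eq0 => /eqP.
have LE : L = - (Qi *m K *m Q).
  by rewrite -mulmxA KL mulmxN opprK mulmxA QiQ mul1mx.
have trLK : \tr (L^T *m K) = 0.
  (* [G] pairs to zero with the first term because [pGp] vanishes, and to the same number
     [\tr (L^T *m K)] with each of the other two. *)
  have HE : H = p *m H *m p + K + K^T.
    have -> : K^T = q *m H *m p by rewrite /K !trmx_mul sp sq sH mulmxA.
    rewrite -{1}[H]mul1mx -{1}[_ *m H]mulmx1 -pq !mulmxDl !mulmxDr qHq addr0.
    by rewrite /K.
  have LKE : \tr (L^T *m K) = \tr (G *m K).
    rewrite /L !trmx_mul sp sq sG !mulmxA mxtrace_mulC /K.
    rewrite !mulmxA qq -[q *m G *m p *m p]mulmxA pp -!mulmxA.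
    by rewrite mxtrace_mulC !mulmxA -!mulmxA.
  have LKE' : \tr (G *m K^T) = \tr (L^T *m K).
    by rewrite LKE -mxtrace_tr trmx_mul trmxK sG mxtrace_mulC.
  have : inner G (p *m H *m p) = 0.
    by rewrite /inner mulmxA mxtrace_mulC !mulmxA pGp mul0mx mxtrace0.
  move: GH0; rewrite {1}HE 2!innerDr => + h; rewrite h add0r /inner LKE' -LKE.
  by move=> ?; lra.
have pQi : pdmx Qi.
  apply: pdmxE => [|v Qiv]; last by rewrite -[v]mul1mx -QQi -mulmxA Qiv mulmx0.
  have := psdmx_conj Qi (pdmx_psd pQ).
  by rewrite sQi -mulmxA QQi mulmx1.
(* By [LE], [\tr (L^T *m K)] is minus the pairing of [Q] with [K^T Qi K]. Both are semidefinite, so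
   their product vanishes; cancelling [Q] and repeating with [Qi] and [K K^T] leaves [K K^T = 0]. *)
have K0 : K = 0.
  have : inner Q (K^T *m Qi *m K) = 0.
    move: trLK; rewrite LE linearN /= mulNmx linearN /= !trmx_mul sQ sQi.
    by move=> /eqP; rewrite oppr_eq0 /inner !mulmxA => /eqP.
  move=> /(inner_psd_eq0 (pdmx_psd pQ) (psdmx_conj K (pdmx_psd pQi))).
  move=> /(congr1 (mulmx Qi)); rewrite (mulmxA Qi Q) QiQ mul1mx mulmx0 => KQK.
  have : inner Qi (K *m K^T) = 0.
    by rewrite /inner (mulmxA Qi) mxtrace_mulC (mulmxA K^T) KQK mxtrace0.
  have pKK : psdmx (K *m K^T) by have := psdmx_gram K^T; rewrite trmxK.
  move=> /(inner_psd_eq0 (pdmx_psd pQi) pKK) /(congr1 (mulmx Q)).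
  rewrite (mulmxA Q Qi) QQi mul1mx mulmx0 => KK.
  by apply: trmx_inj; rewrite trmx0; apply: trmul_eq0; rewrite trmxK.
have L0 : L = 0 by rewrite LE K0 mulmx0 mul0mx oppr0.
have Hq : H *m q = 0.
  by rewrite -[H]mul1mx -pq !mulmxDl -/K K0 qHq addr0.
have Gp : G *m p = 0.
  rewrite -[G]mul1mx -pq !mulmxDl pGp add0r.
  by apply: trmx_inj; rewrite !trmx_mul sp sq sG mulmxA trmx0; exact: L0.
split.
- by rewrite -qQ mulmxA Hq mul0mx.
- by rewrite -pQE mulmxA Gp mul0mx.
- apply: submx_ker => v Xv; rewrite -[v]mul1mx -pq mulmxDl pD -mulmxA Xv mulmx0.
  by rewrite add0r mulmxA Hq mul0mx.
- apply: submx_ker => v Sv; rewrite -[v]mul1mx -pq mulmxDl qD -(mulmxA Qi S) Sv.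
  by rewrite mulmx0 addr0 mulmxA Gp mul0mx.
Qed.

Lemma pdmx_rank X S : pdmx (X + S) -> (n <= \rank X + \rank S)%N.
Proof.
by move=> /pdmx_unit/mxrank_unit {1}<-; exact: mxrank_add.
Qed.

(** [X S = 0] puts the row space of [X] inside the kernel of [S], and the rank bound makes them
    equal. A common kernel vector thus lies in the range of [X] and is orthogonal to it. *)
Lemma complementary_rank_pd X S : psdmx X -> psdmx S -> X *m S = 0 ->
  (n <= \rank X + \rank S)%N -> pdmx (X + S).
Proof.
move=> pX pS XS rn; apply: pdmxE => [|v XSv]; first exact: psdmxD.
have [sX _] := pX; have [sS _] := pS.
have [Xv Sv] := psdmxD_ker pX pS XSv.
have XkS : (X <= kermx S)%MS by apply/sub_kermxP.
have kSX : (kermx S <= X)%MS.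
  by rewrite -(geq_leqif (mxrank_leqif_sup XkS)) mxrank_ker leq_subLR addnC.
have : (v^T <= X)%MS.
  apply: submx_trans kSX; apply/sub_kermxP.
  by rewrite -[LHS]trmxK trmx_mul trmxK sS Sv trmx0.
by move=> /submxP[D vE]; apply: sqnorm_eq0; rewrite vE -mulmxA Xv mulmx0 mxE.
Qed.

End StrictComplementarity.

Section UniqueStrict.
Variables (R : realType) (n m : nat) (P : param_sdp R n m).
Hypothesis hsym : symmetric_data P.

(** A kernel direction is tangent to the optimal faces: small steps along [H] and [G] stay
    semidefinite by the range inclusions, and [H S = 0], [G X = 0] keep complementarity. The stepped
    points are optimal, so uniqueness makes the direction zero. *)
Lemma unique_strict_jacobian_unit e X y S :
  primal_optimal P e = [set X] -> dual_optimal P e = [set (y, S)] ->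
  inner S X = 0 -> pdmx (X + S) -> Defs.jacobian P X y S \in unitmx.
Proof.
move=> uX uS SX0 pXS.
have [[AX pX] _] : primal_optimal P e X by rewrite uX.
have [[/= AS pS] _] : dual_optimal P e (y, S) by rewrite uS.
have XS : X *m S = 0 by apply: inner_psd_eq0 => //; rewrite innerC.
apply: jacobian_unit => //; [by case: pX|by case: pS|].
move=> H dy G sH sG AH AdG E.
have HG : inner G H = 0.
  have := congr1 (fun Z => inner Z H) AdG; rewrite inner0l innerDl inner_adjoint.
  by rewrite big1 ?add0r// => i _; rewrite AH mulr0.
have [HS GX HX GS] := strict_complementary_kernel pX pS sH sG XS pXS E HG.
have [c c0 pc] := psdmx_perturb pX sH HX.
have [d d0 pd] := psdmx_perturb pS sG GS.
have fX : primal_feasible P (X + c *: H).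
  split=> [i|]; first by rewrite innerDr innerZr AH mulr0 addr0 AX.
  by apply: pc; rewrite gtr0_norm.
have fS : dual_feasible P e (y + d *: dy, S + d *: G).
  split=> /=; last by apply: pd; rewrite gtr0_norm.
  rewrite -/(adjoint P _) [y + _]addrC adjoint_linear [_ + adjoint P y]addrC.
  by rewrite addrACA -scalerDr AdG scaler0 addr0.
have H0 : H = 0.
  have /(optimal_of_complementary fX (conj AS pS))[] : inner S (X + c *: H) = 0.
    by rewrite innerDr innerZr SX0 (innerC S) {1}/inner HS mxtrace0 mulr0 addr0.
  rewrite uX /= => /eqP; rewrite -subr_eq0 addrC addKr scaler_eq0 gt_eqF//=.
  by move=> /eqP.
have /(optimal_of_complementary (conj AX pX) fS)[_] : inner (S + d *: G) X = 0.
  by rewrite innerDl innerZl SX0 {1}/inner GX mxtrace0 mulr0 addr0.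
rewrite uS /= => -[/eqP + /eqP].
rewrite -subr_eq0 addrC addKr scaler_eq0 gt_eqF//= => /eqP dy0.
by rewrite -subr_eq0 addrC addKr scaler_eq0 gt_eqF//= => /eqP.
Qed.

End UniqueStrict.

(** * Comparison of optimal solutions at neighbouring parameters *)

Section PartitionNearPoint.
Variables (R : realType) (n m : nat) (P : param_sdp R n m).
Variables (Xs : R -> 'M[R]_n) (ys : R -> 'cV[R]_m) (Ss : R -> 'M[R]_n).
Hypotheses (hsym : symmetric_data P) (hint : interior_point_at0 P)
  (hsel : max_complementary_selection P Xs ys Ss).
Implicit Types (e : R).

Let oX e (ie : int_params P e) := selected_primal hsel ie.
Let oS e (ie : int_params P e) := selected_dual hsel ie.
Let pX e (ie : int_params P e) : psdmx (Xs e) := (oX ie).1.2.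
Let pS e (ie : int_params P e) : psdmx (Ss e) := (oS ie).1.2.
Let SX0 e (ie : int_params P e) : inner (Ss e) (Xs e) = 0 :=
  optimal_complementary hsym hint hsel ie (oX ie) (oS ie).

(* Interpolating the dual solutions at [e0] and [e1] keeps [Xs e0] optimal at
   every nearby [e]. If a strictly complementary pair exists at [e], moving from
   [Ss e0] towards its [S] gives a strictly complementary pair at [e0]. *)
Lemma same_partN_strict e0 e1 : int_params P e0 -> int_params P e1 ->
  e1 != e0 -> partN Ss e1 = partN Ss e0 ->
  exists2 d, 0 < d & forall e, int_params P e -> `|e - e0| < d ->
    pdmx (Xs e + Ss e) -> has_strictly_complementary P e0.
Proof.
move=> i0 i1 ne N01; pose Y := Ss e1 - Ss e0.
have [sS0 _] := pS i0; have [sS1 _] := pS i1.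
have sS01 : (Ss e1 <= Ss e0)%MS.
  have : (partN Ss e1 <= partN Ss e0)%MS by rewrite N01.
  by rewrite /partN sS0 sS1 !genmxE.
have XS0 : Xs e0 *m Ss e0 = 0.
  by apply: inner_psd_eq0; [exact: pX|exact: pS|rewrite innerC SX0].
have S1X0 : inner (Ss e1) (Xs e0) = 0.
  have /submxP[D ->] := sS01; rewrite /inner -mulmxA mxtrace_mulC.
  by rewrite (symmx_mul0C _ _ XS0) ?mul0mx ?mxtrace0//; exact: (pX i0).1.
have YX0 : inner Y (Xs e0) = 0 by rewrite innerBl S1X0 SX0// subrr.
have sY : symmx Y by apply: symmxB.
have YS : (Y <= Ss e0)%MS by rewrite addmx_sub// eqmx_opp.
have [c c0 pc] := psdmx_perturb (pS i0) sY YS.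
have e10 : 0 < `|e1 - e0| by rewrite normr_gt0 subr_eq0.
(* Half the radius, so that [Ss e0 + (2 * t) *: Y] is semidefinite as well. *)
exists (c / 2 * `|e1 - e0|); first by rewrite !mulr_gt0 ?invr_gt0.
move=> e ie ed pXS; pose t := (e - e0) / (e1 - e0).
have tc : `|t| < c / 2 by rewrite normf_div ltr_pdivrMr.
have te : e0 + t * (e1 - e0) = e by rewrite /t divfK ?subr_eq0// addrC subrK.
have := dual_feasible_affine t (oS i0).1 (oS i1).1; rewrite te /= -/Y.
set yt := ys e0 + _; set St := Ss e0 + _ => Et.
have pSt : psdmx St by apply: pc; lra.
have dSt : dual_feasible P e (yt, St) by [].
have [oX0e oSte] : primal_optimal P e (Xs e0) /\ dual_optimal P e (yt, St).
  apply: optimal_of_complementary dSt _; first exact: (oX i0).1.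
  by rewrite innerDl innerZl YX0 SX0// mulr0 addr0.
have StX : inner St (Xs e) = 0.
  exact: (optimal_complementary hsym hint hsel ie (oX ie) oSte).
have S0X_ge0 : 0 <= inner (Ss e0) (Xs e) by apply: inner_psd_ge0; [exact: pS|exact: pX].
(* The pairing of [Xs e] with [Ss e0 + s *: Y] is affine in [s], non-negative at [0] and at [2 * t],
   and zero at the midpoint [t]; hence it vanishes at [0]. *)
have tYX_ge0 : 0 <= inner (Ss e0) (Xs e) + 2 * t * inner Y (Xs e).
  rewrite -innerZl -innerDl; apply: inner_psd_ge0; last exact: pX.
  by apply: pc; rewrite normrM ger0_norm//; lra.
rewrite innerDl innerZl in StX.
have S0X : inner (Ss e0) (Xs e) = 0 by lra.
(* [Ss e] and [St] are both dual feasible at [e], so adding a multiple of their difference stays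
   feasible at [e0]. The weight [2^-1] makes [S2] the mean of [Ss e] and the reflected point
   [Ss e0 - t *: Y]. *)
pose S2 := Ss e0 + 2^-1 *: (Ss e - St); pose y2 := ys e0 + 2^-1 *: (ys e - yt).
have S2E : S2 = 2^-1 *: Ss e + 2^-1 *: (Ss e0 + (- t) *: Y).
  by apply/matrixP => i j; rewrite !mxE; field.
have pS2' : psdmx (2^-1 *: (Ss e0 + (- t) *: Y)).
  by apply: psdmxZ => //; apply: pc; rewrite normrN; lra.
have pS2 : psdmx S2.
  by rewrite S2E; apply: psdmxD => //; apply: psdmxZ => //; exact: pS.
have dS2 : dual_feasible P e0 (y2, S2).
  split=> //=; rewrite -/(adjoint P _).
  have := (oS ie).1.1; have := (oS i0).1.1; have := Et.
  rewrite /= -!/(adjoint P _) => <- E0 E.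
  rewrite -E0 /y2 addrC [ys e0 + _]addrC adjoint_linear.
  have -> : adjoint P (ys e - yt) = adjoint P (ys e) - adjoint P yt.
    by rewrite addrC -scaleN1r adjoint_linear scaleN1r addrC.
  have -> : adjoint P (ys e) = adjoint P yt + St - Ss e.
    by rewrite -E addrK.
  by apply/matrixP => i j; rewrite !mxE; ring.
have S2X : inner S2 (Xs e) = 0.
  rewrite S2E innerDl !innerZl innerDl innerZl SX0// S0X; lra.
have [oXe oS2] := optimal_of_complementary (oX ie).1 dS2 S2X.
exists (Xs e), y2, S2; split=> //.
have -> : Xs e + S2 = (2^-1 *: Xs e + 2^-1 *: (Ss e0 + (- t) *: Y)) +
    2^-1 *: (Xs e + Ss e).
  by apply/matrixP => i j; rewrite S2E !mxE; field.
apply: pdmxD_psd; last by apply: pdmxZ.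
by apply: psdmxD => //; apply: psdmxZ => //; exact: pX.
Qed.

Lemma inner_cost_shift e e0 X :
  inner (cost_at P e) X = inner (cost_at P e0) X + (e - e0) * inner (dcost P) X.
Proof. by rewrite -innerZl -innerDl -cost_atD addrC subrK. Qed.

(** Pairing [Xs e] with a definite slack at [e0], and [Ss e] with a definite primal point, turns
    bounds on objectives into trace bounds. The cost shift at [Xs e] is itself of the order of the
    trace and has to be absorbed. *)
Lemma selected_trace_bound e0 : int_params P e0 -> exists r M, 0 < r /\
  forall e, `|e - e0| < r ->
    [/\ int_params P e, \tr (Xs e) <= M & \tr (Ss e) <= M].
Proof.
move=> i0; have [r1 r10 r1P] := int_params_near i0.
have [[y1 S1] [dS1 /= pdS1]] := dual_slater hint hsel i0.
have [X1 [_ [_ [pX1 _ pdX1 _]]]] := hint.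
have [c c0 trS1] := inner_pd_ge_trace pdS1.
have [c' c'0 trX1] := inner_pd_ge_trace pdX1.
have sD : symmx (dcost P) by case: hsym.
have [k k0 trD] := inner_le_trace sD.
have [k' k'0 trC] := inner_le_trace (symmx_cost_at hsym e0).
(* Within [c / (2 * k)] the cost shift uses up at most half of the constant [c]; the other half is
   the denominator in [M1]. The bound [1] lets factors [|e - e0|] be dropped. *)
pose r := Num.min r1 (Num.min 1 (c / (2 * k))).
pose B1 := inner (cost_at P e0) (Xs e0) - dual_objective P y1 +
  `|inner (dcost P) (Xs e0)|.
pose M1 := B1 / (c / 2).
pose B2 := `|inner (cost_at P e0) X1| + `|inner (dcost P) X1| + (k' + k) * M1.
exists r, (Num.max M1 (B2 / c')); split.
  by rewrite !lt_min r10 ltr01 divr_gt0// mulr_gt0.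
move=> e; rewrite !lt_min => /and3P[/r1P ie h1 h2].
have hk : `|e - e0| * k <= c / 2.
  rewrite ltr_pdivlMr ?mulr_gt0// in h2; lra.
have trX0 := psdmx_trace_ge0 (pX ie).
have hx (x : R) : (e - e0) * x <= `|x|.
  by apply: le_trans (ler_norm _) _; rewrite normrM ler_piMl// ltW.
have hD (X : 'M[R]_n) : psdmx X ->
    - ((e - e0) * inner (dcost P) X) <= `|e - e0| * k * \tr X.
  move=> psdX; apply: le_trans (ler_norm _) _; rewrite normrN normrM -mulrA.
  by rewrite ler_wpM2l// trD.
have leX : \tr (Xs e) <= M1.
  rewrite /M1 ler_pdivlMr ?divr_gt0// mulrC.
  have := trS1 _ (pX ie); rewrite -(duality_gap (oX ie).1 dS1).
  have := (oX ie).2 _ (oX i0).1; rewrite !(inner_cost_shift e e0).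
  have := hx (inner (dcost P) (Xs e0)); have := hD _ (pX ie).
  have : `|e - e0| * k * \tr (Xs e) <= c / 2 * \tr (Xs e) by rewrite ler_wpM2r.
  by rewrite /B1; lra.
split=> //; first by rewrite le_max leX.
rewrite le_max; apply/orP; right; rewrite ler_pdivlMr// mulrC.
have := trX1 _ (pS ie); rewrite innerC -(duality_gap pX1 (oS ie).1).
have := duality_gap (oX ie).1 (oS ie).1; rewrite SX0// !(inner_cost_shift e e0).
have := hx (inner (dcost P) X1); have := ler_norm (inner (cost_at P e0) X1).
have : - inner (cost_at P e0) (Xs e) <= k' * M1.
  apply: le_trans (ler_norm _) _; rewrite normrN; apply: le_trans (trC _ (pX ie)) _.
  by rewrite ler_wpM2l// ltW.
have : - ((e - e0) * inner (dcost P) (Xs e)) <= k * M1.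
  apply: le_trans (hD _ (pX ie)) _; rewrite -mulrA.
  apply: (@le_trans _ _ (k * \tr (Xs e))); last by rewrite ler_wpM2l// ltW.
  by rewrite ler_piMl ?mulr_ge0// ltW.
by rewrite /B2; lra.
Qed.

(** Both left-hand sides are non-negative and their sum is exactly the common right-hand side. *)
Lemma cross_gap_le e0 e : int_params P e0 -> int_params P e ->
  inner (Ss e0) (Xs e) <= (e - e0) * inner (dcost P) (Xs e0 - Xs e) /\
  inner (Ss e) (Xs e0) <= (e - e0) * inner (dcost P) (Xs e0 - Xs e).
Proof.
move=> i0 ie.
have := duality_gap (oX ie).1 (oS i0).1; have := duality_gap (oX i0).1 (oS ie).1.
have := duality_gap (oX ie).1 (oS ie).1; have := duality_gap (oX i0).1 (oS i0).1.
rewrite !SX0// !(inner_cost_shift e e0) innerBr.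
have := (oX ie).2 _ (oX i0).1; rewrite !(inner_cost_shift e e0).
have := (oX i0).2 _ (oX ie).1.
by split; lra.
Qed.

End PartitionNearPoint.

(** * Persistence of a nonsingular Jacobian near a unique solution *)

Section BlockContinuity.
Variables (R : realType) (T : topologicalType).

Lemma entry_continuous_row_mx k p q (A : T -> 'M[R]_(k, p)) (B : T -> 'M[R]_(k, q)) :
  entry_continuous A -> entry_continuous B ->
  entry_continuous (fun x => row_mx (A x) (B x)).
Proof.
move=> cA cB i j; case: (split_ordP j) => l ->.
  by under eq_fun do rewrite row_mxEl; exact: cA.
by under eq_fun do rewrite row_mxEr; exact: cB.
Qed.

Lemma entry_continuous_col_mx k p q (A : T -> 'M[R]_(p, k)) (B : T -> 'M[R]_(q, k)) :
  entry_continuous A -> entry_continuous B ->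
  entry_continuous (fun x => col_mx (A x) (B x)).
Proof.
move=> cA cB i j; case: (split_ordP i) => l ->.
  by under eq_fun do rewrite col_mxEu; exact: cA.
by under eq_fun do rewrite col_mxEd; exact: cB.
Qed.

Lemma entry_continuous_castmx p q p' q' (E : (p = p') * (q = q'))
    (A : T -> 'M[R]_(p, q)) :
  entry_continuous A -> entry_continuous (fun x => castmx E (A x)).
Proof. by move=> cA i j; under eq_fun do rewrite castmxE; exact: cA. Qed.

Lemma entry_continuous_skron n (A B : T -> 'M[R]_n) :
  entry_continuous A -> entry_continuous B ->
  entry_continuous (fun x => skron (A x) (B x)).
Proof.
move=> cA cB i j; under eq_fun do rewrite mxE.
apply: entry_continuousZ; apply: entry_continuous_svec.
by apply: entry_continuousD; apply: entry_continuousM;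
  [apply: entry_continuousM| | apply: entry_continuousM|] => //;
  try exact: entry_continuous_cst; exact: entry_continuousT.
Qed.

Lemma entry_continuous_jacobian n m (P : param_sdp R n m) y (X S : T -> 'M[R]_n) :
  entry_continuous X -> entry_continuous S ->
  entry_continuous (fun x => Defs.jacobian P (X x) y (S x)).
Proof.
move=> cX cS; apply: entry_continuous_castmx; apply: entry_continuous_col_mx.
  exact: entry_continuous_cst.
by do ![apply: entry_continuous_row_mx | apply: entry_continuous_skron |
  exact: entry_continuous_cst | done].
Qed.

Lemma entry_continuous_mxvec k p (A : T -> 'M[R]_(k, p)) :
  entry_continuous A -> entry_continuous (fun x => mxvec (A x)).
Proof.
move=> cA i l; rewrite ord1; case/mxvec_indexP: l => a b.
by under eq_fun do rewrite mxvecE; exact: cA.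
Qed.

End BlockContinuity.

Section RegularNearUnique.
Variables (R : realType) (n m : nat) (P : param_sdp R n m).
Variables (Xs : R -> 'M[R]_n) (ys : R -> 'cV[R]_m) (Ss : R -> 'M[R]_n).
Hypotheses (hsym : symmetric_data P) (hint : interior_point_at0 P)
  (hsel : max_complementary_selection P Xs ys Ss).

(** The class of [S] modulo the span of the constraints: dual feasibility with the multiplier
    eliminated, so that compactness is only required of [X] and [S]. *)
Definition adjoint_residual (S : 'M[R]_n) : 'rV[R]_(n * n) :=
  mxvec S *m cokermx (\matrix_(i < m) mxvec (constr P i)).

Lemma adjoint_residual_linear a S S' :
  adjoint_residual (a *: S + S') = a *: adjoint_residual S + adjoint_residual S'.
Proof. by rewrite /adjoint_residual linearP /= mulmxDl scalemxAl. Qed.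

Lemma adjoint_residual_eq0 S : adjoint_residual S = 0 <-> exists y, S = adjoint P y.
Proof.
have rowE (w : 'rV[R]_m) :
    w *m (\matrix_(i < m) mxvec (constr P i)) = mxvec (adjoint P w^T).
  rewrite mulmx_sum_row linear_sum; apply: eq_bigr => i _.
  by rewrite rowK linearZ /= mxE.
split=> [/eqP|[y ->]].
  rewrite -submxE => /submxP[w]; rewrite rowE => /(can_inj mxvecK) ->.
  by exists w^T.
by rewrite /adjoint_residual -[y]trmxK -rowE -mulmxA mulmx_coker mulmx0.
Qed.

(** Violations of the two linear systems plus the cross gaps with [(X0, S0)]. On semidefinite pairs
    each term is non-negative, and a zero value certifies that [X] and [S] are optimal. *)
Definition optimality_residual e0 (X0 S0 X S : 'M[R]_n) : R :=
  \sum_i (inner (constr P i) X - rhs P i 0) ^+ 2 +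
  \sum_j adjoint_residual (cost_at P e0 - S) 0 j ^+ 2 +
  (inner S0 X + inner S X0).

Lemma optimality_residual_gt0 e0 (X0 S0 X S : 'M[R]_n) y0 :
  primal_optimal P e0 = [set X0] -> dual_optimal P e0 = [set (y0, S0)] ->
  psdmx X -> psdmx S -> (X, S) <> (X0, S0) ->
  0 < optimality_residual e0 X0 S0 X S.
Proof.
move=> uX uS pX pS; have [pfX0 _] : primal_optimal P e0 X0 by rewrite uX.
have [dfS0 _] : dual_optimal P e0 (y0, S0) by rewrite uS.
have g1 := inner_psd_ge0 dfS0.2 pX; have g2 := inner_psd_ge0 pS pfX0.2.
rewrite /= in g1; set s1 := \sum_i (inner (constr P i) X - rhs P i 0) ^+ 2.
set s2 := \sum_j adjoint_residual (cost_at P e0 - S) 0 j ^+ 2.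
have s10 : 0 <= s1 by apply: sumr_ge0 => i _; rewrite sqr_ge0.
have s20 : 0 <= s2 by apply: sumr_ge0 => i _; rewrite sqr_ge0.
rewrite lt_def; case: eqVneq => //= [res0 []|_ _]; last first.
  by rewrite /optimality_residual !addr_ge0.
rewrite /optimality_residual -/s1 -/s2 in res0.
have s1_0 : s1 = 0 by lra.
have s2_0 : s2 = 0 by lra.
have fX : primal_feasible P X.
  split=> // i; move/eqP: s1_0; rewrite psumr_eq0; last first.
    by move=> j _; rewrite sqr_ge0.
  move=> /allP/(_ i (mem_index_enum _)) /=.
  by rewrite sqrf_eq0 subr_eq0 => /eqP.
have /adjoint_residual_eq0[y yE] : adjoint_residual (cost_at P e0 - S) = 0.
  apply/rowP => j; rewrite [RHS]mxE; move/eqP: s2_0; rewrite psumr_eq0; last first.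
    by move=> k _; rewrite sqr_ge0.
  by move=> /allP/(_ j (mem_index_enum _)) /=; rewrite sqrf_eq0 => /eqP.
have fS : dual_feasible P e0 (y, S).
  by split=> //=; rewrite -/(adjoint P y) -yE subrK.
have [+ _] := optimal_of_complementary fX dfS0 (ltac:(lra)).
rewrite uX /= => ->.
have [_ +] := optimal_of_complementary pfX0 fS (ltac:(lra)).
by rewrite uS /= => -[_ ->].
Qed.

(** [K] collects the bounded semidefinite pairs with singular Jacobian. It avoids the unique
    solution, so the residual has a positive minimum on it; near [e0] the residual of the selected
    pair falls below that minimum, which keeps the pair out of [K]. *)
Lemma jacobian_unit_near e0 : int_params P e0 ->
  primal_optimal P e0 = [set Xs e0] -> dual_optimal P e0 = [set (ys e0, Ss e0)] ->
  Defs.jacobian P (Xs e0) (ys e0) (Ss e0) \in unitmx ->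
  exists2 r, 0 < r & forall e, `|e - e0| < r ->
    int_params P e /\ Defs.jacobian P (Xs e) (ys e) (Ss e) \in unitmx.
Proof.
move=> i0 uX uS J0; have [r [M [r0 rM]]] := selected_trace_bound hsym hint hsel i0.
pose J X S := Defs.jacobian P X (ys e0) S.
pose g (Z : 'M[R]_(n, n + n)) :=
  optimality_residual e0 (Xs e0) (Ss e0) (lsubmx Z) (rsubmx Z).
have cL : entry_continuous (fun Z : 'M[R]_(n, n + n) => lsubmx Z).
  by move=> i j; under eq_fun do rewrite mxE; exact: coord_continuous.
have cR : entry_continuous (fun Z : 'M[R]_(n, n + n) => rsubmx Z).
  by move=> i j; under eq_fun do rewrite mxE; exact: coord_continuous.
pose K := [set Z : 'M[R]_(n, n + n) | psdmx (lsubmx Z)] `&`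
  [set Z | psdmx (rsubmx Z)] `&` [set Z | \tr (lsubmx Z) <= M] `&`
  [set Z | \tr (rsubmx Z) <= M] `&` [set Z | \det (J (lsubmx Z) (rsubmx Z)) = 0].
have cK : closed K.
  apply: closedI; first (apply: closedI; first (apply: closedI; first apply: closedI)).
  - exact: closed_psdmx cL.
  - exact: closed_psdmx cR.
  - by apply: closed_continuous_le; exact: continuous_mxtrace.
  - by apply: closed_continuous_le; exact: continuous_mxtrace.
  - apply: closed_continuous_eq; apply: continuous_det.
    exact: entry_continuous_jacobian.
have bK Z : K Z -> forall i j, `|Z i j| <= M.
  move=> [[[[pL pR] tL] tR] _] i j; rewrite -[Z]hsubmxK.
  case: (split_ordP j) => l ->; rewrite ?row_mxEl ?row_mxEr.
    exact: le_trans (psdmx_entry_le _ _ pL) tL.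
  exact: le_trans (psdmx_entry_le _ _ pR) tR.
have cg : continuous g.
  have csq (f : 'M[R]_(n, n + n) -> R) (a : R) :
      continuous f -> continuous (fun Z => (f Z - a) ^+ 2).
    move=> cf; under eq_fun do rewrite expr2.
    have cfa : continuous (fun Z => f Z - a).
      by apply: continuous_addr => //; exact: cst_continuous.
    exact: continuous_mulr.
  apply: continuous_addr; first apply: continuous_addr.
  - apply: continuous_sumr => i; apply: csq; apply: continuous_inner => //.
    exact: entry_continuous_cst.
  - apply: continuous_sumr => j.
    under eq_fun do rewrite -[adjoint_residual _ 0 j]subr0; apply: csq.
    apply: entry_continuousM; last exact: entry_continuous_cst.
    apply: entry_continuous_mxvec; apply: entry_continuousB => //.
    exact: entry_continuous_cst.
  - by apply: continuous_addr; apply: continuous_inner => //;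
      exact: entry_continuous_cst.
have g0 Z : K Z -> 0 < g Z.
  move=> [[[[pL pR] tL] tR] dJ]; apply: (optimality_residual_gt0 uX uS) => //.
  by move=> -[EL ER]; move: J0; rewrite unitmxE unitfE /= -EL -ER dJ eqxx.
have sD : symmx (dcost P) by case: hsym.
have [k k0 trD] := inner_le_trace sD.
pose nu := \sum_j adjoint_residual (dcost P) 0 j ^+ 2.
have nu0 : 0 <= nu by apply: sumr_ge0 => j _; rewrite sqr_ge0.
have M0 : 0 <= M.
  have [_ + _] := rM e0 (ltac:(by rewrite subrr normr0)).
  by apply: le_trans; exact: psdmx_trace_ge0 (selected_primal hsel i0).1.2.
pose Ze e := row_mx (Xs e) (Ss e).
(* [nu] accounts for the shift [(e0 - e) *: dcost P] in the dual equations, and [4 * k * M] for the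
   two cross gaps, at most [|e - e0| * (2 * k * M)] each. *)
have gZe e : `|e - e0| < r -> `|e - e0| <= 1 -> g (Ze e) <= `|e - e0| * (nu + 4 * k * M).
  move=> er e1; have [ie tX tS] := rM _ er.
  have [_ tX0 _] := rM e0 (ltac:(by rewrite subrr normr0)).
  have [oXe oSe] := (selected_primal hsel ie, selected_dual hsel ie).
  have oX0 := selected_primal hsel i0.
  rewrite /g /Ze row_mxKl row_mxKr /optimality_residual.
  rewrite big1 ?add0r; last by move=> i _; rewrite (oXe.1.1 i) subrr expr0n.
  have [c1 c2] := cross_gap_le hsym hint hsel i0 ie.
  have -> : \sum_j adjoint_residual (cost_at P e0 - Ss e) 0 j ^+ 2 = `|e - e0| ^+ 2 * nu.
    rewrite /nu mulr_sumr; apply: eq_bigr => j _.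
    have -> : cost_at P e0 - Ss e = (e0 - e) *: dcost P + (cost_at P e - Ss e).
      have -> : cost_at P e0 = cost_at P e + (e0 - e) *: dcost P.
        by rewrite -cost_atD addrC subrK.
      by rewrite addrAC addrC addrA addrAC addrC.
    rewrite adjoint_residual_linear.
    have -> : adjoint_residual (cost_at P e - Ss e) = 0.
      by apply/adjoint_residual_eq0; exists (ys e); rewrite -oSe.1.1 /= addrK.
    by rewrite addr0 mxE exprMn real_normK ?num_real// -sqrrN opprB.
  have cross : (e - e0) * inner (dcost P) (Xs e0 - Xs e) <= `|e - e0| * (2 * k * M).
    apply: le_trans (ler_norm _) _; rewrite normrM ler_wpM2l// innerBr.
    apply: le_trans (ler_normB _ _) _.
    have := trD _ oX0.1.2; have := trD _ oXe.1.2.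
    have : k * \tr (Xs e) <= k * M by rewrite ler_wpM2l// ltW.
    have : k * \tr (Xs e0) <= k * M by rewrite ler_wpM2l// ltW.
    by lra.
  have h2 : `|e - e0| ^+ 2 * nu <= `|e - e0| * nu.
    by rewrite ler_wpM2r// expr2 ler_piMl.
  by lra.
have KZe e : `|e - e0| < r ->
    Defs.jacobian P (Xs e) (ys e) (Ss e) \notin unitmx -> K (Ze e).
  move=> er Jn; have [ie tX tS] := rM _ er.
  have dJ : \det (J (Xs e) (Ss e)) = 0.
    by move: Jn; rewrite unitmxE unitfE negbK => /eqP.
  have pX := (selected_primal hsel ie).1.2; have pS := (selected_dual hsel ie).1.2.
  rewrite /K /Ze /= row_mxKl row_mxKr.
  exact: (conj (conj (conj (conj pX pS) tX) tS) dJ).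
have [[Z0 KZ0]|K0] := pselect (K !=set0); last first.
  exists r => // e er; split; first by have [] := rM _ er.
  by apply: contra_notT K0 => /(KZe _ er) ?; exists (Ze e).
have [Zm KZm minZ] := mx_bounded_closed_min cK bK (ex_intro _ _ KZ0) cg.
have gm := g0 _ KZm.
(* The [+ 1] ensures that [c] is positive. *)
pose c := nu + 4 * k * M + 1.
have c0 : 0 < c by rewrite /c ltr_wpDl// addr_ge0// !mulr_ge0// ltW.
exists (Num.min r (Num.min 1 (g Zm / c))); first by rewrite !lt_min r0 ltr01 divr_gt0.
move=> e; rewrite !lt_min => /and3P[er /ltW e1 egm]; split; first by have [] := rM _ er.
apply: contraT => /(KZe _ er) /minZ; have := gZe _ er e1.
rewrite ltr_pdivlMr// /c in egm; have : 0 <= `|e - e0| by [].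
by lra.
Qed.

End RegularNearUnique.

(** * Change of the partition at the boundary of the regular interval *)

Theorem theorem3p9 (R : realType) (n m : nat) (P : param_sdp R n m)
  (hsym : symmetric_data P)
  (hfree : independent_constraints P)
  (hint : interior_point_at0 P)
  (Xs : R -> 'M[R]_n) (ys : R -> 'cV[R]_m) (Ss : R -> 'M[R]_n)
  (hsel : max_complementary_selection P Xs ys Ss)
  (Ireg : set R) (hIreg : maximal_regular_interval P Xs ys Ss Ireg)
  (ebar : R) (hebar : int_params P ebar)
  (hbd : boundary Ireg ebar) :
  (~ has_strictly_complementary P ebar -> transition_point P Xs Ss ebar) /\
  (singleton_set (primal_optimal P ebar) ->
   singleton_set (dual_optimal P ebar) -> transition_point P Xs Ss ebar).
Proof.
have [[itvI openI subI unitI] maxI] := hIreg.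
have [clI nintI] := hbd.
have near_reg d : 0 < d -> exists2 e, Ireg e & `|e - ebar| < d.
  move=> d0; have /clI[e [Ie]] : nbhs ebar (ball ebar d) by exact: nbhsx_ballx.
  by rewrite /ball /= distrC => ed; exists e.
have pX e (ie : int_params P e) := (selected_primal hsel ie).1.2.
have pS e (ie : int_params P e) := (selected_dual hsel ie).1.2.
have strictI e : Ireg e -> pdmx (Xs e + Ss e).
  move=> Ie; have ie := subI _ Ie.
  exact: (jacobian_strict (pX _ ie) (pS _ ie) (unitI _ Ie)).
have rankB e : int_params P e -> \rank (partB Xs e) = \rank (Xs e).
  by move=> ie; rewrite mxrank_gen mxrank_tr.
have rankN e : int_params P e -> \rank (partN Ss e) = \rank (Ss e).
  by move=> ie; rewrite mxrank_gen mxrank_tr.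
have not_strict_transition :
    ~ has_strictly_complementary P ebar -> transition_point P Xs Ss ebar.
  move=> nstrict; split=> //; split.
    apply/seteqP; split=> [e1 [i1 pi1]|_ ->//].
    apply: contrapT => /eqP ne; apply: nstrict.
    have [_ _ N1] := pi1.
    have [d d0 strict_d] := same_partN_strict hsym hint hsel hebar i1 ne N1.
    have [e Ie ed] := near_reg _ d0.
    exact: strict_d (subI _ Ie) ed (strictI _ Ie).
  move=> xi xi0 _; have [e Ie ed] := near_reg _ xi0; have ie := subI _ Ie.
  exists e; split; first by rewrite -ltr_distl.
  apply: contrapT => /not_orP[/contrapT eB /contrapT eN]; apply: nstrict.
  have oX := selected_primal hsel hebar; have oS := selected_dual hsel hebar.
  exists (Xs ebar), (ys ebar), (Ss ebar); split=> //.
  apply: complementary_rank_pd; [exact: pX|exact: pS| |].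
    apply: inner_psd_eq0; [exact: pX|exact: pS|rewrite innerC].
    exact: (optimal_complementary hsym hint hsel hebar oX oS).
  rewrite -(rankB _ hebar) -(rankN _ hebar) -eB -eN rankB// rankN//.
  exact: pdmx_rank (strictI _ Ie).
split=> // -[X0 uX] [[y0 S0] uS]; apply: not_strict_transition.
move=> [X [y [S [oX oS pXS]]]]; apply: nintI.
have oXb := selected_primal hsel hebar; have oSb := selected_dual hsel hebar.
have SX0 := optimal_complementary hsym hint hsel hebar oXb oSb.
have uXb : primal_optimal P ebar = [set Xs ebar].
  by move: oXb; rewrite uX /= => ->.
have uSb : dual_optimal P ebar = [set (ys ebar, Ss ebar)].
  by move: oSb; rewrite uS /= => ->.
have pXSb : pdmx (Xs ebar + Ss ebar).
  by move: oX oS pXS; rewrite uXb uSb /= => -> [_ ->].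
have Jb := unique_strict_jacobian_unit hsym uXb uSb SX0 pXSb.
have [r r0 near_unit] := jacobian_unit_near hsym hint hsel hebar uXb uSb Jb.
pose I' := Ireg `|` [set e | `|e - ebar| < r].
(* A point of [Ireg] inside the ball: since the two intervals meet, their union is again an
   interval. *)
have [e0 Ie0 e0r] := near_reg _ r0.
have regI' : regular_interval P Xs ys Ss I'.
  split.
  - move=> x z I'x I'z t /andP[xt tz].
    have [tr|tr] := ltP `|t - ebar| r; first by right.
    left; move: e0r I'x I'z; rewrite ltr_distl => /andP[re0 e0r].
    move: tr; rewrite ler_normr => /orP[tr|tr] I'x I'z.
      case: I'z => [Iz|/=]; last by rewrite ltr_distl => /andP[]; lra.
      by apply: (itvI e0 z) => //; apply/andP; split; lra.
    case: I'x => [Ix|/=]; last by rewrite ltr_distl => /andP[]; lra.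
    by apply: (itvI x e0) => //; apply/andP; split; lra.
  - apply: openU => //.
    have -> : [set e | `|e - ebar| < r] = ball ebar r.
      by apply/seteqP; split=> e; rewrite /ball /= distrC.
    exact: ball_open.
  - by move=> e [/subI//|/near_unit[]].
  - by move=> e [/unitI//|/near_unit[]].
have I'E := maxI _ regI' (@subsetUl _ _ _).
have : Ireg ebar by rewrite -I'E; right; rewrite /= subrr normr0.
by move: openI; rewrite openE; apply.
Qed.
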